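(* There is a universal constant $C'>0$ such that the following holds in the regression setting described in the context. Fix $t\in\mathbb{Z}_+$, $\delta\in(0,1)$ and $f_1,f_2\in\mathcal{F}$, and run the Adaptive Rolling Window model comparison procedure with $\delta'=\delta/(3t)$ and $M=8M_0^2$. With probability at least $1-\delta$, its output $\widehat f$ satisfies $$\|\widehat f-f_t^*\|_{\mathcal{P}}-\min_{r\in\{1,2\}}\|f_r-f_t^*\|_{\mathcal{P}}\le C'\sqrt{\log(6t/\delta)}\min_{k\in[t]}\left\{\max_{t-k+1\le j\le t}\|f_j^*-f_t^*\|_{\mathcal{P}}+\frac{M_0}{\sqrt{B_{t,k}}}\right\}.$$
   Context: Let $\mathcal{X}$ be a feature space, $M_0>0$, and $\mathcal{F}$ a set of measurable functions $f:\mathcal{X}\to\mathbb{R}$ with $|f(x)|\le M_0$ for all $x\in\mathcal{X}$, $f\in\mathcal{F}$. Samples are $z=(x,y)\in\mathcal{X}\times\mathbb{R}$ and the loss is $\ell(f,(x,y))=(f(x)-y)^2$. For $j\in\mathbb{Z}_+$, $\mathcal{P}_j$ is a distribution of $(x,y)$ with $|y|\le M_0$ almost surely, and all $\mathcal{P}_j$ share the same marginal distribution $\mathcal{P}$ of $x$ (no covariate shift). Let $L_j(f)=\mathbb{E}_{(x,y)\sim\mathcal{P}_j}(f(x)-y)^2$, $f_j^*(x)=\mathbb{E}_{\mathcal{P}_j}[y\mid x]$, and $\|h\|_{\mathcal{P}}=\sqrt{\mathbb{E}_{x\sim\mathcal{P}}h(x)^2}$. For $j\in[t]$ the batch $\{z_{j,i}\}_{i=1}^{B_j}$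 ($B_j\ge1$) consists of i.i.d. samples from $\mathcal{P}_j$, independent across $j$; $B_{t,k}=\sum_{j=t-k+1}^tB_j$. Adaptive Rolling Window (mean estimation) with hyperparameters $\delta'\in(0,1)$, $M>0$, applied to real data $\{u_{j,i}\}_{j\in[t],i\in[B_j]}$: for $k\in[t]$ let $\widehat\mu_{t,k}=\frac{1}{B_{t,k}}\sum_{j=t-k+1}^t\sum_{i=1}^{B_j}u_{j,i}$; when $B_{t,k}\ge2$, $\widehat v_{t,k}^2=\frac{1}{B_{t,k}-1}\sum_{j=t-k+1}^t\sum_{i=1}^{B_j}(u_{j,i}-\widehat\mu_{t,k})^2$ with $\widehat v_{t,k}\ge0$; $\widehat\psi(t,k,\delta')=M$ if $B_{t,k}=1$ and $\widehat\psi(t,k,\delta')=\widehat v_{t,k}\sqrt{2\log(2/\delta')/B_{t,k}}+\frac{8M\log(2/\delta')}{3(B_{t,k}-1)}$ if $B_{t,k}\ge2$; $\widehat\phi(t,k,\delta')=\max_{i\in[k]}\big(|\widehat\mu_{t,k}-\widehat\mu_{t,i}|-[\widehat\psi(t,k,\delta')+\widehat\psi(t,i,\delta')]\big)_+$ with $x_+=\max\{x,0\}$; choose any $\widehat k\in\mathop{\mathrm{argmin}}_{k\in[t]}\{\widehat\phi(t,k,\delta')+\widehat\psi(t,k,\delta')\}$ and output $\widehat\mu_{t,\widehat k}$. Adaptive Rolling Window model comparison with hyperparameters $\delta',M$: set $u_{j,i}=\ell(f_1,z_{j,i})-\ell(f_2,z_{j,i})$, run the mean-estimation procedure above on these data with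 $\delta',M$ to obtain $\widehat\Delta_{t,\widehat k}$, and output $\widehat f=f_1$ if $\widehat\Delta_{t,\widehat k}\le 0$ and $\widehat f=f_2$ otherwise. *)

(* Defs.v *)
From HB Require Import structures.
From mathcomp Require Import all_boot all_order all_algebra.
From mathcomp Require Import all_classical all_reals all_analysis.
Set Implicit Arguments. Unset Strict Implicit. Unset Printing Implicit Defensive.
Import Order.TTheory GRing.Theory Num.Theory.
Local Open Scope classical_set_scope.
Local Open Scope ring_scope.

Section ARW.
Variable R : realType.

(* Batch indices: j ranges over [t] = {1,..,t}, i over {0,..,B_j - 1}. *)

Definition Btk (B : nat -> nat) (t k : nat) : nat :=
  (\sum_((t - k).+1 <= j < t.+1) B j)%N.

Definition mu_hat (u : nat -> nat -> R) (B : nat -> nat) (t k : nat) : R :=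
  (\sum_((t - k).+1 <= j < t.+1) \sum_(0 <= i < B j) u j i) / (Btk B t k)%:R.

Definition v_hat (u : nat -> nat -> R) (B : nat -> nat) (t k : nat) : R :=
  Num.sqrt ((\sum_((t - k).+1 <= j < t.+1) \sum_(0 <= i < B j)
               (u j i - mu_hat u B t k) ^+ 2) / ((Btk B t k)%:R - 1)).

Definition psi_hat (M delta' : R) (u : nat -> nat -> R) (B : nat -> nat)
    (t k : nat) : R :=
  if Btk B t k == 1%N then M
  else v_hat u B t k * Num.sqrt (2 * ln (2 / delta') / (Btk B t k)%:R)
       + 8 * M * ln (2 / delta') / (3 * ((Btk B t k)%:R - 1)).

Definition phi_hat (M delta' : R) (u : nat -> nat -> R) (B : nat -> nat)
    (t k : nat) : R :=
  \big[Num.max/0]_(1 <= i < k.+1)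
     Num.max (`|mu_hat u B t k - mu_hat u B t i|
              - (psi_hat M delta' u B t k + psi_hat M delta' u B t i)) 0.

Definition is_khat (M delta' : R) (u : nat -> nat -> R) (B : nat -> nat)
    (t k : nat) : Prop :=
  (1 <= k <= t)%N /\
  forall k', (1 <= k' <= t)%N ->
    phi_hat M delta' u B t k + psi_hat M delta' u B t k
    <= phi_hat M delta' u B t k' + psi_hat M delta' u B t k'.

Definition sqloss {X : Type} (f : X -> R) (z : X * R) : R := (f z.1 - z.2) ^+ 2.

Definition arw_compare {X : Type} (f1 f2 : X -> R) (u : nat -> nat -> R)
    (B : nat -> nat) (t khat : nat) : X -> R :=
  if mu_hat u B t khat <= 0 then f1 else f2.

Definition normP {d} {X : measurableType d} (P : probability X R) (h : X -> R) : R :=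
  Num.sqrt (fine (\int[P]_x ((h x) ^+ 2)%:E)).

(* g is a version of the conditional expectation E_{Pj}[y | x], where the
   marginal of Pj on x is P *)
Definition cond_exp_y {d} {X : measurableType d} (P : probability X R)
    (Pj : probability (X * R)%type R) (g : X -> R) : Prop :=
  measurable_fun setT g /\ P.-integrable setT (EFin \o g) /\
  forall A : set X, measurable A ->
    (\int[Pj]_(z in A `*` setT) (z.2)%:E = \int[P]_(x in A) (g x)%:E)%E.

Definition batches_indep {dO d} {Omega : measurableType dO}
    {Z : measurableType d} (Prob : probability Omega R)
    (z : nat -> nat -> Omega -> Z) (B : nat -> nat) (t : nat) : Prop :=
  forall A : nat -> nat -> set Z,
    (forall j i, measurable (A j i)) ->
    Prob (\bigcap_(j in [set j | (1 <= j <= t)%N])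
            \bigcap_(i in [set i | (i < B j)%N]) (z j i @^-1` A j i))
    = (\prod_(1 <= j < t.+1) \prod_(0 <= i < B j)
         fine (Prob (z j i @^-1` A j i)))%:E.

End ARW.

(* Main.v *)
Require Import Defs.
From HB Require Import structures.
From mathcomp Require Import all_boot all_order all_algebra.
From mathcomp Require Import all_classical all_reals all_analysis.
From mathcomp Require Import measurable_realfun ring lra.
Set Implicit Arguments. Unset Strict Implicit. Unset Printing Implicit Defensive.
Import Order.TTheory GRing.Theory Num.Theory numFieldNormedType.Exports.
Import HBNNSimple.
Local Open Scope classical_set_scope.
Local Open Scope ring_scope.

(** The excess risk of a candidate is read off the performance gap
  [D_j = E_j (loss f1 - loss f2) = |f1 - f_j*|^2 - |f2 - f_j*|^2]. Since the
  covariates share one marginal, [|D_j - D_t| <= 2 |f1 - f2| |f_j* - f_t*|], and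
  the second moment of the loss difference is at most [16 M0^2 |f1 - f2|^2]. An
  empirical Bernstein inequality on every window makes [psi_hat] a valid
  confidence radius, and the Goldenshluger-Lepski rule then estimates [D_t] with
  error [O(|f1 - f2| (bias + M0 r) + M0^2 r^2)], [r = sqrt (L / B_{t,k})]. A
  wrong selection needs an error of at least [|a1 - a2| (a1 + a2)], where
  [a_i = |f_i - f_t*|]; dividing by [a1 + a2 >= |f1 - f2|] gives the claim.

  The empirical Bernstein inequality avoids the entropy method. A Bernstein
  bound for the sum (in terms of the true variance [q^2]) is combined with the
  lower tail [q <= sqrt (sum W^2) + b sqrt L]. Replacing the true mean by the
  sample mean costs a term controlled through [q^2 <= n b (M - b)]; this
  variance bound, with [b = M / 2 + |m|] the range of [W], is what keeps the
  total below the constant [8 / 3]. *)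

(** * Expectations of bounded functions *)

(** The bound is required everywhere rather than almost everywhere, so the class does not depend on
    a measure and is closed under sums, products, powers and composition. Integrability under every
    probability then comes for free. *)
Definition bounded_measurable {d} {T : measurableType d} {R : realType}
    (f : T -> R) : Prop :=
  measurable_fun setT f /\ exists C, forall x, `|f x| <= C.

Lemma bounded_measurable_cst {d} {T : measurableType d} {R : realType} (c : R) :
  bounded_measurable (fun _ : T => c).
Proof. by split; [exact: measurable_cst | exists `|c|]. Qed.

Lemma bounded_measurableD {d} {T : measurableType d} {R : realType}
    (f g : T -> R) :
  bounded_measurable f -> bounded_measurable g ->
  bounded_measurable (fun x => f x + g x).
Proof.
move=> [mf [C fC]] [mg [D gD]]; split; first exact: measurable_funD.
by exists (C + D) => x; rewrite (le_trans (ler_normD _ _)) ?lerD.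
Qed.

Lemma bounded_measurableM {d} {T : measurableType d} {R : realType}
    (f g : T -> R) :
  bounded_measurable f -> bounded_measurable g ->
  bounded_measurable (fun x => f x * g x).
Proof.
move=> [mf [C fC]] [mg [D gD]]; split; first exact: measurable_funM.
by exists (C * D) => x; rewrite normrM ler_pM.
Qed.

Lemma bounded_measurableZ {d} {T : measurableType d} {R : realType}
    (c : R) (f : T -> R) :
  bounded_measurable f -> bounded_measurable (fun x => c * f x).
Proof. by apply: bounded_measurableM; exact: bounded_measurable_cst. Qed.

Lemma bounded_measurableN {d} {T : measurableType d} {R : realType}
    (f : T -> R) :
  bounded_measurable f -> bounded_measurable (fun x => - f x).
Proof.
move=> [mf [C fC]]; split; first exact: measurableT_comp.
by exists C => x; rewrite normrN.
Qed.

Lemma bounded_measurableB {d} {T : measurableType d} {R : realType}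
    (f g : T -> R) :
  bounded_measurable f -> bounded_measurable g ->
  bounded_measurable (fun x => f x - g x).
Proof. by move=> bf /bounded_measurableN; exact: bounded_measurableD. Qed.

Lemma bounded_measurableX {d} {T : measurableType d} {R : realType}
    (f : T -> R) n :
  bounded_measurable f -> bounded_measurable (fun x => f x ^+ n).
Proof.
move=> bf; elim: n => [|n IHn]; first exact: bounded_measurable_cst.
by under eq_fun do rewrite exprS; exact: bounded_measurableM.
Qed.

Lemma bounded_measurable_expR {d} {T : measurableType d} {R : realType}
    (f : T -> R) :
  bounded_measurable f -> bounded_measurable (fun x => expR (f x)).
Proof.
move=> [mf [C fC]]; split; first exact: measurableT_comp.
exists (expR C) => x; rewrite ger0_norm ?expR_ge0// ler_expR.
exact: le_trans (ler_norm _) (fC x).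
Qed.

Lemma bounded_measurable_comp {d d'} {T : measurableType d}
    {U : measurableType d'} {R : realType} (f : U -> R) (g : T -> U) :
  bounded_measurable f -> measurable_fun setT g ->
  bounded_measurable (fun x => f (g x)).
Proof.
move=> [mf [C fC]] mg; split; first exact: measurableT_comp.
by exists C.
Qed.

Lemma bounded_measurable_indic {d} {T : measurableType d} {R : realType}
    (A : set T) :
  measurable A -> bounded_measurable (\1_A : T -> R).
Proof.
move=> mA; split; first exact: measurable_indic.
by exists 1 => x; rewrite indicE; case: (x \in A); rewrite ?normr1 ?normr0.
Qed.

Lemma bounded_measurable_prod {d} {T : measurableType d} {R : realType}
    (I : eqType) (s : seq I) (f : I -> T -> R) :
  {in s, forall l, bounded_measurable (f l)} ->
  bounded_measurable (fun x => \prod_(l <- s) f l x).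
Proof.
elim: s => [_|l s IHs bf].
  by under eq_fun do rewrite big_nil; exact: bounded_measurable_cst.
under eq_fun do rewrite big_cons.
apply: bounded_measurableM; first by apply: bf; rewrite mem_head.
by apply: IHs => i si; apply: bf; rewrite in_cons si orbT.
Qed.

Lemma bounded_measurable_sum {d} {T : measurableType d} {R : realType}
    (I : eqType) (s : seq I) (f : I -> T -> R) :
  {in s, forall l, bounded_measurable (f l)} ->
  bounded_measurable (fun x => \sum_(l <- s) f l x).
Proof.
elim: s => [_|l s IHs bf].
  by under eq_fun do rewrite big_nil; exact: bounded_measurable_cst.
under eq_fun do rewrite big_cons.
apply: bounded_measurableD; first by apply: bf; rewrite mem_head.
by apply: IHs => i si; apply: bf; rewrite in_cons si orbT.
Qed.

Lemma bounded_integrable {d} {T : measurableType d} {R : realType}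
    (P : probability T R) (f : T -> R) :
  bounded_measurable f -> P.-integrable setT (EFin \o f).
Proof.
move=> [mf [C fC]]; apply: measurable_bounded_integrable => //.
  by rewrite -ge0_fin_numE// fin_num_measure.
exists C; split; first by rewrite num_real.
by move=> D CD x _; exact: le_trans (fC x) (ltW CD).
Qed.

Lemma EFin_Rintegral {d} {T : measurableType d} {R : realType}
    (P : probability T R) (f : T -> R) :
  bounded_measurable f -> (\int[P]_x (f x)%:E)%E = (\int[P]_x f x)%:E.
Proof.
move=> bf; rewrite /Rintegral fineK//.
exact: integrable_fin_num (bounded_integrable P bf).
Qed.

Lemma expectD {d} {T : measurableType d} {R : realType} (P : probability T R)
    (f g : T -> R) : bounded_measurable f -> bounded_measurable g ->
  \int[P]_x (f x + g x) = \int[P]_x f x + \int[P]_x g x.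
Proof. by move=> bf bg; rewrite RintegralD//; exact: bounded_integrable. Qed.

Lemma expectB {d} {T : measurableType d} {R : realType} (P : probability T R)
    (f g : T -> R) : bounded_measurable f -> bounded_measurable g ->
  \int[P]_x (f x - g x) = \int[P]_x f x - \int[P]_x g x.
Proof. by move=> bf bg; rewrite RintegralB//; exact: bounded_integrable. Qed.

Lemma expectZ {d} {T : measurableType d} {R : realType} (P : probability T R)
    c (f : T -> R) : bounded_measurable f ->
  \int[P]_x (c * f x) = c * \int[P]_x f x.
Proof. by move=> bf; rewrite RintegralZl//; exact: bounded_integrable. Qed.

Lemma expect_cst {d} {T : measurableType d} {R : realType}
    (P : probability T R) (c : R) : \int[P]_x c = c.
Proof. by rewrite Rintegral_cst// [X in fine X](_ : _ = 1%E) ?mulr1//; exact: probability_setT. Qed.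

Lemma le_expect {d} {T : measurableType d} {R : realType} (P : probability T R)
    (f g : T -> R) : bounded_measurable f -> bounded_measurable g ->
  (forall x, f x <= g x) -> \int[P]_x f x <= \int[P]_x g x.
Proof.
move=> bf bg fg.
by apply: le_Rintegral => //; exact: bounded_integrable.
Qed.

Lemma expect_indic {d} {T : measurableType d} {R : realType}
    (P : probability T R) (A : set T) : measurable A ->
  \int[P]_x \1_A x = fine (P A).
Proof. by move=> mA; rewrite /Rintegral integral_indic// setIT. Qed.

(* Two weighted laws that agree on measurable sets integrate every nonnegative
   function alike. This yields products of expectations, changes of variables
   and the characterization of conditional expectations. *)
Lemma integral_weighted_law {d1 d2 dZ} {T1 : measurableType d1}
    {T2 : measurableType d2} {Z : measurableType dZ} {R : realType}
    (m1 : {measure set T1 -> \bar R}) (m2 : {measure set T2 -> \bar R})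
    (H1 : T1 -> R) (H2 : T2 -> R) (Y1 : T1 -> Z) (Y2 : T2 -> Z) (f : Z -> R) :
  measurable_fun setT H1 -> measurable_fun setT H2 ->
  (forall x, 0 <= H1 x) -> (forall x, 0 <= H2 x) ->
  measurable_fun setT Y1 -> measurable_fun setT Y2 ->
  measurable_fun setT f -> (forall z, 0 <= f z) ->
  (forall A, measurable A ->
     (\int[m1]_x (H1 x * \1_A (Y1 x))%:E = \int[m2]_x (H2 x * \1_A (Y2 x))%:E)%E) ->
  (\int[m1]_x (H1 x * f (Y1 x))%:E = \int[m2]_x (H2 x * f (Y2 x))%:E)%E.
Proof.
move=> mH1 mH2 H10 H20 mY1 mY2 mf f0 HA.
have mEf : measurable_fun setT (EFin \o f) by exact/measurable_EFinP.
(* Increasing simple functions [h n] approximate [f]; monotone convergence reduces the claim to each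
   [h n], and linearity over its finite range reduces that to indicators. *)
pose h := nnsfun_approx measurableT mEf.
have hnd (z : Z) : {homo (fun n => h n z) : a b / (a <= b)%N >-> a <= b}.
  by move=> a b ab; exact/lefP/nd_nnsfun_approx.
have mh n : measurable_fun setT (h n : Z -> R) by exact: measurable_funP.
have h0 n z : 0 <= h n z by [].
have lim d (T : measurableType d) (m : {measure set T -> \bar R})
      (H : T -> R) (Y : T -> Z) :
    measurable_fun setT H -> (forall x, 0 <= H x) -> measurable_fun setT Y ->
    (\int[m]_x (H x * f (Y x))%:E =
      limn (fun n => \int[m]_x (H x * h n (Y x))%:E))%E.
  move=> mH H0 mY.
  rewrite -monotone_convergence//.
  - apply: eq_integral => x _; apply/esym/cvg_lim => //.
    under eq_fun do rewrite EFinM; rewrite EFinM.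
    apply: cvgeZl => //.
    have := @cvg_nnsfun_approx _ _ _ _ measurableT (EFin \o f) mEf.
    move=> /(_ (fun x _ => f0 x)) /(_ (Y x) I); exact.
  - move=> n; apply/measurable_EFinP; apply: measurable_funM => //.
    exact: (measurableT_comp (mh n)).
  - by move=> n x _; rewrite lee_fin mulr_ge0.
  - by move=> x _ a b ab; rewrite lee_fin ler_wpM2l// hnd.
rewrite (lim _ _ m1 H1 Y1)// (lim _ _ m2 H2 Y2)//; congr (limn _).
apply/funext => n.
(* The coefficient is written [|y|] so that every summand is visibly nonnegative; on the range of
   [h n] it equals [y]. *)
have fs d (T : measurableType d) (m : {measure set T -> \bar R})
      (H : T -> R) (Y : T -> Z) :
    measurable_fun setT H -> (forall x, 0 <= H x) -> measurable_fun setT Y ->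
    (\int[m]_x (H x * h n (Y x))%:E = \sum_(y \in range (h n))
       (`|y|%:E * \int[m]_x (H x * \1_(h n @^-1` [set y]) (Y x))%:E))%E.
  move=> mH H0 mY.
  have mI y : measurable_fun setT
      (fun x => (H x * \1_(h n @^-1` [set y]) (Y x))%:E).
    apply/measurable_EFinP; apply: measurable_funM => //.
    by apply: measurableT_comp mY; exact: measurable_indic.
  have I0 y x : (0 <= (H x * \1_(h n @^-1` [set y]) (Y x))%:E)%E.
    by rewrite lee_fin mulr_ge0.
  transitivity (\int[m]_x \sum_(y \in range (h n))
      (`|y|%:E * (H x * \1_(h n @^-1` [set y]) (Y x))%:E))%E.
    apply: eq_integral => x _; rewrite fimfunE mulr_fsumr// -fsumEFin//.
    apply: eq_fsbigr => y; rewrite inE => -[z _ <-].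
    by rewrite -EFinM ger0_norm// mulrCA.
  rewrite ge0_integral_fsum//.
  - by apply: eq_fsbigr => y _; rewrite ge0_integralZl.
  - by move=> y; apply: measurable_funeM.
  - by move=> y x _; rewrite mule_ge0// lee_fin.
rewrite (fs _ _ m1 H1 Y1)// (fs _ _ m2 H2 Y2)//.
by apply: eq_fsbigr => y _; rewrite HA.
Qed.

Lemma expect_law {d1 dZ} {T : measurableType d1} {Z : measurableType dZ}
    {R : realType} (P : probability T R) (Q : probability Z R) (Y : T -> Z)
    (f : Z -> R) :
  measurable_fun setT Y ->
  (forall A, measurable A -> P (Y @^-1` A) = Q A) ->
  bounded_measurable f ->
  \int[P]_x f (Y x) = \int[Q]_z f z.
Proof.
move=> mY law bf; have [mf [C fC]] := bf.
(* Shifting by [C] gives the nonnegative integrand that [integral_weighted_law] needs. Both measures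
   have mass one, so the shift cancels at the end. *)
have ge z : 0 <= f z + C by have := fC z; rewrite ler_norml; lra.
have bfC := bounded_measurableD bf (@bounded_measurable_cst _ Z R C).
have mI A : measurable A -> measurable (Y @^-1` A).
  by move=> mA; rewrite -[X in measurable X]setTI; exact: mY.
have := @integral_weighted_law _ _ _ T Z Z R P Q (fun=> 1) (fun=> 1) Y id
  (fun z => f z + C).
move=> /(_ (measurable_cst _) (measurable_cst _) (fun _ => ler01) (fun _ => ler01)
  mY (@measurable_id _ Z setT) bfC.1 ge) H.
have {H} : (\int[P]_x (1 * (f (Y x) + C))%:E = \int[Q]_x (1 * (f x + C))%:E)%E.
  apply: H => A mA; under eq_integral do rewrite mul1r.
  under [RHS]eq_integral do rewrite mul1r.
  transitivity (P (Y @^-1` A)); last by rewrite law// integral_indic// setIT.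
  rewrite -[in RHS](setIT (Y @^-1` A)).
  by rewrite -[RHS]integral_indic//; exact: mI.
under eq_integral do rewrite mul1r; under [RHS]eq_integral do rewrite mul1r.
move=> /(congr1 fine).
rewrite -!/(Rintegral _ _ _).
have E : \int[P]_x (f (Y x) + C) = \int[Q]_z (f z + C) ->
    \int[P]_x f (Y x) = \int[Q]_z f z.
  rewrite !expectD//; [|exact: bounded_measurable_cst|
    exact: bounded_measurable_comp|exact: bounded_measurable_cst].
  by rewrite !expect_cst; lra.
exact: E.
Qed.

(** * Independence and exponential moments *)

(** Only the product over the full list is asked for: sublists are recovered by taking [A l = setT]
    elsewhere. *)
Definition independent_on {d dZ} {T : measurableType d}
    {Z : measurableType dZ} {R : realType} (P : probability T R) {I : choiceType}
    (s : seq I) (Y : I -> T -> Z) : Prop :=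
  forall A : I -> set Z, (forall l, measurable (A l)) ->
    P (\bigcap_(l in [set l | l \in s]) (Y l @^-1` A l))
    = (\prod_(l <- s) fine (P (Y l @^-1` A l)))%:E.

(** Induction on the list [Q] of indices whose function is not yet an indicator. When all are
    indicators, the claim is the definition of independence. *)
Lemma expect_prod {d dZ} {T : measurableType d} {Z : measurableType dZ}
    {R : realType} (P : probability T R) {I : choiceType} (s : seq I)
    (Y : I -> T -> Z) (f : I -> Z -> R) :
  uniq s -> {in s, forall l, measurable_fun setT (Y l)} ->
  independent_on P s Y ->
  (forall l, bounded_measurable (f l)) -> (forall l z, 0 <= f l z) ->
  \int[P]_w (\prod_(l <- s) f l (Y l w)) = \prod_(l <- s) \int[P]_w f l (Y l w).
Proof.
move=> us mY indep.
(* The functions are replaced one at a time by arbitrary indicators. *)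
suff gen (Q : seq I) : forall f : I -> Z -> R,
    (forall l, bounded_measurable (f l)) -> (forall l z, 0 <= f l z) ->
    {in s, forall l, l \in Q \/ exists A, f l = \1_A} ->
    \int[P]_w (\prod_(l <- s) f l (Y l w))
    = \prod_(l <- s) \int[P]_w f l (Y l w).
  by move=> bf f0; apply: (gen s) => // l ls; left.
elim: Q => [|q Q IHQ] {}f bf f0 fQ.
  (* The sets in the hypothesis carry no measurability, so they are recovered as preimages of 1
     under the measurable [f l]. *)
  pose A l := f l @^-1` [set 1].
  have mA l : measurable (A l).
    by rewrite -[A l]setTI; apply: (bf l).1.
  have fA l : l \in s -> f l = \1_(A l).
    move=> ls; have [//|[B fB]] := fQ l ls; rewrite fB; congr (\1_ _).
    apply/seteqP; rewrite /A fB; split=> z /=; rewrite indicE.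
      by move=> Bz; rewrite mem_set.
    by case: (boolP (z \in B)) => [/set_mem//|_ /eqP]; rewrite eq_sym oner_eq0.
  pose E := \bigcap_(l in [set l | l \in s]) (Y l @^-1` A l).
  have mYA l : l \in s -> measurable (Y l @^-1` A l).
    by move=> ls; rewrite -[X in measurable X]setTI; exact: mY.
  have mE : measurable E.
    rewrite /E (bigcap_seq s) big_seq.
    by apply: bigsetI_measurable => l ls; exact: mYA.
  transitivity (\int[P]_w \1_E w).
    apply: eq_Rintegral => w _.
    have [Ew|nEw] := pselect (E w).
      by rewrite indicE mem_set// big_seq big1.
    rewrite indicE memNset//.
    have [l /not_implyP[ls nA]] : exists l, ~ (l \in s -> A l (Y l w)).
      by apply/existsNP => H; apply: nEw => l /= ls; exact: H.
    by rewrite (big_rem l)//= fA// indicE memNset// mul0r.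
  rewrite expect_indic// indep//= big_seq [RHS]big_seq.
  apply: eq_bigr => l ls; rewrite fA// -expect_indic//; last exact: mYA.
have [qs|nqs] := boolP (q \in s); last first.
  apply: IHQ => // l ls; have [|] := fQ l ls; last by right.
  by rewrite in_cons => /predU1P[lq|]; [rewrite -lq ls in nqs | left].
set c := \prod_(l <- rem q s) \int[P]_w f l (Y l w).
pose H w := \prod_(l <- rem q s) f l (Y l w).
have bfY l : l \in s -> bounded_measurable (fun w => f l (Y l w)).
  by move=> ls; apply: bounded_measurable_comp => //; exact: mY.
have bH : bounded_measurable H.
  by apply: bounded_measurable_prod => l /mem_rem; exact: bfY.
have H0 w : 0 <= H w by exact: prodr_ge0.
have c0 : 0 <= c by apply: prodr_ge0 => l _; exact: Rintegral_ge0.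
(* The law of [Y q] weighted by the other factors [H] and the one weighted by the constant [c] agree
   on sets, by the induction hypothesis with [f q] replaced by an indicator. Hence they agree on
   [f q]. *)
have key : (\int[P]_w (H w * f q (Y q w))%:E
    = \int[P]_w (c * f q (Y q w))%:E)%E.
  apply: (@integral_weighted_law _ _ _ T T Z R P P H (fun=> c) (Y q) (Y q)) => //.
  - exact: bH.1.
  - exact: mY.
  - exact: mY.
  - exact: (bf q).1.
  move=> A mA.
  pose f' l := if l == q then \1_A else f l.
  have b1 : bounded_measurable (\1_A : Z -> R) by exact: bounded_measurable_indic.
  have b1Y : bounded_measurable (fun w => \1_A (Y q w) : R).
    by apply: (bounded_measurable_comp b1); exact: mY.
  have := IHQ f'; rewrite !(big_rem _ qs)/=.
  have f'q : f' q = \1_A by rewrite /f' eqxx.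
  have f'E l : l \in rem q s -> f' l = f l.
    by rewrite mem_rem_uniq// inE => /andP[/negPf lq _]; rewrite /f' lq.
  rewrite f'q.
  have -> : \prod_(l <- rem q s) \int[P]_w f' l (Y l w) = c.
    by rewrite big_seq [RHS]big_seq; apply: eq_bigr => l /f'E ->.
  under eq_Rintegral => w _.
    rewrite (big_rem _ qs)/= f'q.
    have -> : \prod_(l <- rem q s) f' l (Y l w) = H w.
      by rewrite /H big_seq [RHS]big_seq; apply: eq_bigr => l /f'E ->.
    over.
  move=> IH.
  under eq_integral do rewrite mulrC.
  rewrite !EFin_Rintegral; [|
    exact: bounded_measurableM|exact: bounded_measurableZ].
  rewrite expectZ// [c * _]mulrC; congr _%:E; apply: IH.
  - by move=> l; rewrite /f'; case: ifP.
  - by move=> l z; rewrite /f'; case: ifP.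
  move=> l ls; rewrite /f'; case: eqVneq => [_|lq]; first by right; exists A.
  have [|] := fQ l ls; last by right.
  by rewrite in_cons (negPf lq); left.
have bq := bfY _ qs.
have key' : \int[P]_w (H w * f q (Y q w)) = c * \int[P]_w f q (Y q w).
  rewrite -expectZ//; apply: EFin_inj; rewrite -!EFin_Rintegral//.
    exact: bounded_measurableZ.
  exact: bounded_measurableM.
rewrite [RHS](big_rem _ qs)/= -/c mulrC -key'.
by apply: eq_Rintegral => w _; rewrite (big_rem _ qs)/= mulrC.
Qed.

(** The good event [G] is a measurable witness inside [Q], so [Q] itself may be an arbitrary
    predicate, such as one that quantifies over minimizers. *)
Definition holds_except {d} {T : measurableType d} {R : realType}
    (P : probability T R) (Q : T -> Prop) (e : R) : Prop :=
  exists G : set T, [/\ measurable G, (P (~` G) <= e%:E)%E & forall w, G w -> Q w].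

Lemma holds_except_sub {d} {T : measurableType d} {R : realType}
    (P : probability T R) (Q Q' : T -> Prop) (e e' : R) :
  (forall w, Q w -> Q' w) -> e <= e' ->
  holds_except P Q e -> holds_except P Q' e'.
Proof.
move=> QQ' ee' [G [mG PG GQ]]; exists G; split=> //.
  by rewrite (le_trans PG)// lee_fin.
by move=> w /GQ /QQ'.
Qed.

Lemma holds_except_and {d} {T : measurableType d} {R : realType}
    (P : probability T R) (Q Q' : T -> Prop) (e e' : R) :
  holds_except P Q e -> holds_except P Q' e' ->
  holds_except P (fun w => Q w /\ Q' w) (e + e').
Proof.
move=> [G [mG PG GQ]] [G' [mG' PG' GQ']]; exists (G `&` G'); split.
- exact: measurableI.
- rewrite setCI EFinD (le_trans (measureU2 _ _ _)) ?leeD//; exact: measurableC.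
- by move=> w [/GQ ? /GQ' ?].
Qed.

Lemma holds_except_all {d} {T : measurableType d} {R : realType}
    (P : probability T R) {I : choiceType} (s : seq I) (Q : I -> T -> Prop) (e : R) :
  {in s, forall l, holds_except P (Q l) e} ->
  holds_except P (fun w => {in s, forall l, Q l w}) ((size s)%:R * e).
Proof.
elim: s => [_|l s IHs Qe].
  exists setT; split=> //; rewrite setCT mul0r.
  by rewrite [X in (X <= _)%E](_ : _ = 0%E)//; exact: measure0.
have /holds_except_and/(_ (IHs _)) : holds_except P (Q l) e.
  by apply: Qe; rewrite mem_head.
move=> H; apply: holds_except_sub (H _).
- move=> w [Ql Qs] i; rewrite in_cons => /predU1P[->//|].
  exact: Qs.
- by rewrite /= -natr1; lra.
- by move=> i si; apply: Qe; rewrite in_cons si orbT.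
Qed.

Lemma holds_except_ae {d} {T : measurableType d} {R : realType}
    (P : probability T R) (A : set T) :
  measurable A -> P A = 1%E -> holds_except P A 0.
Proof. by move=> mA PA; exists A; split=> //; rewrite probability_setC// PA subee. Qed.

(** Markov's inequality for the exponential of the sum, whose expectation factorizes by
    [expect_prod]. The Chernoff parameter is absorbed in [f], and the exponential moments are
    bounded term by term, since the laws differ across batches. *)
Lemma chernoff_independent {d dZ} {T : measurableType d} {Z : measurableType dZ}
    {R : realType} (P : probability T R) {I : choiceType} (s : seq I)
    (Y : I -> T -> Z) (f : I -> Z -> R) (b : I -> R) (L : R) :
  uniq s -> {in s, forall l, measurable_fun setT (Y l)} ->
  independent_on P s Y ->
  (forall l, bounded_measurable (f l)) ->
  {in s, forall l, \int[P]_w expR (f l (Y l w)) <= expR (b l)} ->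
  holds_except P
    (fun w => \sum_(l <- s) f l (Y l w) <= \sum_(l <- s) b l + L) (expR (- L)).
Proof.
move=> us mY indep bf fb.
pose S w := \sum_(l <- s) f l (Y l w).
have bS : bounded_measurable S.
  by apply: bounded_measurable_sum => l ls; apply: bounded_measurable_comp (mY l ls).
set c := \sum_(l <- s) b l + L.
pose G := [set w | S w <= c].
have mG : measurable G.
  rewrite -[G]setTI.
  have := bS.1 measurableT `]-oo, c]%classic (measurable_itv _).
  by congr measurable; apply/seteqP; split=> w; rewrite /= in_itv.
exists G; split=> //.
have mGC : measurable (~` G) by exact: measurableC.
have eS : \int[P]_w expR (S w) <= expR (\sum_(l <- s) b l).
  under eq_Rintegral do rewrite /S expR_sum.
  rewrite expR_sum (@expect_prod _ _ _ _ _ _ _ _ Y (fun l z => expR (f l z)))//.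
  - rewrite big_seq [leRHS]big_seq; apply: ler_prod => l ls.
    rewrite fb// andbT; apply: Rintegral_ge0 => w _; exact: expR_ge0.
  - by move=> l; exact: bounded_measurable_expR.
rewrite -[P (~` G)]fineK ?fin_num_measure// lee_fin -expect_indic//.
(* Markov's inequality: [expR c] times the indicator of the bad event is below [expR (S w)]. *)
have ec : expR c * \int[P]_w \1_(~` G) w <= \int[P]_w expR (S w).
  rewrite -expectZ; last exact: bounded_measurable_indic.
  apply: le_expect.
  - by apply: bounded_measurableZ; exact: bounded_measurable_indic.
  - exact: bounded_measurable_expR.
  move=> w; rewrite indicE; case: (boolP (w \in _)) => [/set_mem/= /negP|_].
    by rewrite -ltNge mulr1 ler_expR; exact: ltW.
  by rewrite mulr0 expR_ge0.
rewrite -(ler_pM2l (expR_gt0 c)) (le_trans ec)// (le_trans eS)//.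
by rewrite -expRD ler_expR /c; lra.
Qed.

(** * Tail bounds for sums *)

(** The condition [0 <= c * x] says that the intermediate point has the sign of [x], which treats
    positive and negative [x] at once. *)
Lemma MVT_from0 {R : realType} (f df : R -> R) (x : R) :
  (forall y : R, is_derive y (1 : R) f (df y)) ->
  exists c, [/\ 0 <= c * x, `|c| <= `|x| & f x - f 0 = df c * x].
Proof.
move=> fdf.
have cf a b : {within `[a, b], continuous f}.
  by apply: derivable_within_continuous => y _; exact: (@ex_derive _ _ _ _ _ _ _ (fdf y)).
have [x0|x0] := leP 0 x.
  have [c] := MVT_segment x0 (fun y _ => fdf y) (cf _ _).
  rewrite in_itv/= => /andP[c0 cx] E; exists c; split.
  - exact: mulr_ge0.
  - by rewrite !ger0_norm.
  - by rewrite E subr0.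
have [c] := MVT_segment (ltW x0) (fun y _ => fdf y) (cf _ _).
rewrite in_itv/= => /andP[xc c0] E; exists c; split.
- exact: mulr_le0 (ltW x0).
- by rewrite !ler0_norm ?lerN2// ltW.
- by rewrite -opprB E; ring.
Qed.

(** The difference [g] of the two sides vanishes at 0 together with its derivative, and its second
    derivative [(1 - (1 - y) * expR y) / 3] is nonnegative because [1 - y <= expR (- y)]. Two mean
    value steps conclude. *)
Lemma expR_pade_le {R : realType} (z : R) :
  (1 - z / 3) * expR z <= 1 + 2 * z / 3 + z ^+ 2 / 6.
Proof.
pose g2 (y : R) : R := 1 / 3 - (1 / 3 - y / 3) * expR y.
pose g1 (y : R) : R := 2 / 3 + y / 3 - (2 / 3 - y / 3) * expR y.
pose g (y : R) : R := 1 + 2 * y / 3 + y ^+ 2 / 6 - (1 - y / 3) * expR y.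
have g20 y : 0 <= g2 y.
  have : 1 - y <= expR (- y) by have := expR_ge1Dx (- y); lra.
  rewrite -(ler_pM2r (expR_gt0 y)) -expRD addNr expR0 /g2; lra.
have dg1 y : is_derive y (1 : R) g1 (g2 y).
  rewrite /g1 /g2; apply: is_derive_eq; rewrite /GRing.scale/=; lra.
have dg y : is_derive y (1 : R) g (g1 y).
  rewrite /g /g1; apply: is_derive_eq; rewrite /GRing.scale/=; lra.
have [c [cz _ gz]] := MVT_from0 z dg.
have [e [_ _ g1c]] := MVT_from0 c dg1.
have g00 : g 0 = 0 by rewrite /g expR0; lra.
have g10 : g1 0 = 0 by rewrite /g1 expR0; lra.
rewrite g10 subr0 in g1c; rewrite g00 subr0 g1c in gz.
have : 0 <= g z by rewrite gz -mulrA mulr_ge0.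
by rewrite /g subr_ge0.
Qed.

(** Dividing the previous bound by [1 - z / 3] gives exactly [1 + z + z ^+ 2 / (2 * (1 - z / 3))],
    and [z <= a] enlarges the last term. This is the source of the 1/3 in Bernstein's inequality. *)
Lemma expR_le_quadratic {R : realType} (a z : R) : `|z| <= a -> a < 3 ->
  expR z <= 1 + z + z ^+ 2 / (2 * (1 - a / 3)).
Proof.
rewrite ler_norml => /andP[az za] a3.
have z3 : 0 < 1 - z / 3 by lra.
have a3' : 0 < 1 - a / 3 by lra.
apply: (@le_trans _ _ (1 + z + z ^+ 2 / (2 * (1 - z / 3)))); last first.
  rewrite lerD2l ler_wpM2l ?sqr_ge0// lef_pV2 ?posrE; lra.
rewrite -(ler_pM2l z3) (le_trans (expR_pade_le z))//.
rewrite le_eqVlt; apply/orP; left; apply/eqP; field.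
by apply/eqP; lra.
Qed.

(** From [expR (- z) <= (1 + z)^-1 = 1 - z / (1 + z)]. The bound is linear in [z], so a lower tail
    for sums of squares needs no fourth moment. *)
Lemma expRN_le {R : realType} (z c : R) : 0 <= z -> z <= c ->
  expR (- z) <= 1 - z / (1 + c).
Proof.
move=> z0 zc; have c0 : 0 < 1 + c by lra.
have z1 : 0 < 1 + z by lra.
apply: (@le_trans _ _ (1 + z)^-1).
  rewrite expRN lef_pV2 ?posrE ?expR_gt0//; exact: expR_ge1Dx.
apply: (@le_trans _ _ (1 - z / (1 + z))).
  rewrite le_eqVlt; apply/orP; left; apply/eqP; field; apply/eqP; lra.
rewrite lerD2l lerN2 ler_wpM2l// lef_pV2 ?posrE; lra.
Qed.

Lemma expR_le_linear {R : realType} (z : R) : 0 <= z -> z <= 2^-1 ->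
  expR z <= 1 + 2 * z.
Proof.
move=> z0 z2.
have z1 : 0 < 1 - z by lra.
apply: (@le_trans _ _ (1 - z)^-1).
  rewrite -[z]opprK expRN lef_pV2 ?posrE ?expR_gt0 ?opprK//.
  by have := expR_ge1Dx (- z).
by rewrite -(ler_pM2l z1) mulfV ?gt_eqF//; nra.
Qed.

(** Only the total of the means has to vanish: the linear terms of the exponential moments are added
    over the list before they cancel. This suits a window that mixes batches of different laws. *)
Lemma bernstein {d dZ} {T : measurableType d} {Z : measurableType dZ}
    {R : realType} (P : probability T R) {I : choiceType} (s : seq I)
    (Y : I -> T -> Z) (g : Z -> R) (b v L : R) :
  uniq s -> {in s, forall l, measurable_fun setT (Y l)} ->
  independent_on P s Y -> measurable_fun setT g -> (forall z, `|g z| <= b) ->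
  0 < b -> 0 < v -> 0 < L ->
  \sum_(l <- s) \int[P]_w g (Y l w) = 0 ->
  \sum_(l <- s) \int[P]_w g (Y l w) ^+ 2 <= v ->
  holds_except P (fun w => \sum_(l <- s) g (Y l w)
     <= Num.sqrt (2 * L * v) + b * L / 3) (expR (- L)).
Proof.
move=> us mY indep mg gb b0 v0 L0 Eg Eg2.
have bg : bounded_measurable g by split=> //; exists b.
(* With [lam = q / (1 + q * b / 3)] one has [1 - lam * b / 3 = k^-1], and then the Chernoff exponent
   [kap * v + L] is exactly [lam] times the claimed bound. *)
pose q := Num.sqrt (2 * L / v).
have qv : q ^+ 2 * v = 2 * L.
  by rewrite sqr_sqrtr ?divfK ?gt_eqF// ltW// divr_gt0// mulr_gt0.
have q0 : 0 < q by rewrite sqrtr_gt0 divr_gt0// mulr_gt0.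
have sE : Num.sqrt (2 * L * v) = q * v.
  rewrite -qv -[_ * v * v]mulrA -expr2 sqrtrM ?sqr_ge0//.
  by rewrite !sqrtr_sqr !gtr0_norm.
have qb0 : 0 < q * b by exact: mulr_gt0.
pose k := 1 + q * b / 3.
have k0 : 0 < k by rewrite /k; lra.
pose lam := q / k.
have lam0 : 0 < lam by exact: divr_gt0.
have lb3 : lam * b < 3.
  rewrite /lam mulrAC ltr_pdivrMr// /k; lra.
have kE : 1 - lam * b / 3 = k^-1.
  rewrite /lam /k; field; apply/eqP; rewrite /k in k0; lra.
pose kap := lam ^+ 2 / (2 * (1 - lam * b / 3)).
have kap0 : 0 <= kap by rewrite /kap kE divr_ge0 ?sqr_ge0// mulr_ge0// invr_ge0 ltW.
have lamL : kap * v + L = lam * (Num.sqrt (2 * L * v) + b * L / 3).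
  rewrite sE /kap kE /lam.
  have -> : L = q ^+ 2 * v / 2 by rewrite qv; lra.
  rewrite /k; field; apply/eqP; rewrite /k in k0; lra.
have bY l : l \in s -> bounded_measurable (fun w => g (Y l w)).
  by move=> ls; exact: bounded_measurable_comp bg (mY l ls).
have H := @chernoff_independent _ _ _ _ _ P I s Y (fun=> fun z => lam * g z)
  (fun l => lam * \int[P]_w g (Y l w) + kap * \int[P]_w g (Y l w) ^+ 2)
  L us mY indep.
apply: (holds_except_sub _ (lexx _) (H _ _)).
- move=> w; rewrite big_split/= -!mulr_sumr Eg mulr0 add0r => Hw.
  rewrite -(ler_pM2l lam0) (le_trans Hw)// -lamL lerD2r.
  by rewrite ler_wpM2l.
- by move=> _; exact: bounded_measurableZ.
- move=> l ls; have bl := bY l ls.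
  have bl2 := bounded_measurableX 2 bl.
  have b1 := @bounded_measurable_cst _ T R 1.
  have bZ1 := bounded_measurableZ lam bl.
  have bZ2 := bounded_measurableZ kap bl2.
  have bD := bounded_measurableD bZ1 bZ2.
  rewrite (le_trans _ (expR_ge1Dx _))//.
  rewrite -[X in _ <= X + _](expect_cst P) -!expectZ// -!expectD//.
  apply: le_expect.
  + by apply: bounded_measurable_expR; exact: bounded_measurableZ.
  + apply: bounded_measurableD; first exact: bounded_measurable_cst.
    by apply: bounded_measurableD; exact: bounded_measurableZ.
  move=> w; rewrite addrA [X in _ + X](_ : _ = (lam * g (Y l w)) ^+ 2
    / (2 * (1 - lam * b / 3))); last by rewrite /kap; ring.
  apply: expR_le_quadratic => //.
  by rewrite normrM (gtr0_norm lam0) ler_pM2l.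
Qed.

(** For squares in [[0, b ^+ 2]], [expRN_le] bounds the moment of [expR (- lam * g ^+ 2)]. The best
    [lam] turns the Chernoff bound into a perfect square, so the loss on the scale of square roots
    is just [b * Num.sqrt L]. *)
Lemma sum_square_lower_tail {d dZ} {T : measurableType d}
    {Z : measurableType dZ} {R : realType} (P : probability T R)
    {I : choiceType} (s : seq I) (Y : I -> T -> Z) (g : Z -> R) (b L : R) :
  uniq s -> {in s, forall l, measurable_fun setT (Y l)} ->
  independent_on P s Y -> measurable_fun setT g -> (forall z, `|g z| <= b) ->
  0 < b -> 0 < L ->
  holds_except P (fun w =>
    Num.sqrt (\sum_(l <- s) \int[P]_w g (Y l w) ^+ 2)
    <= Num.sqrt (\sum_(l <- s) g (Y l w) ^+ 2) + b * Num.sqrt L) (expR (- L)).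
Proof.
move=> us mY indep mg gb b0 L0.
have bg : bounded_measurable g by split=> //; exists b.
set v := \sum_(l <- s) \int[P]_w g (Y l w) ^+ 2.
have v0 : 0 <= v by apply: sumr_ge0 => l _; apply: Rintegral_ge0 => *; exact: sqr_ge0.
set q := Num.sqrt v; set r := Num.sqrt L.
have r0 : 0 < r by rewrite sqrtr_gt0.
have r2 : r ^+ 2 = L by rewrite sqr_sqrtr ?ltW.
have q2 : q ^+ 2 = v by rewrite sqr_sqrtr.
have br0 : 0 < b * r by exact: mulr_gt0.
(* For [q <= b * r] the claim is deterministic; otherwise [D] is positive and may appear in a
   denominator. *)
have [qr|qr] := leP q (b * r).
  exists setT; split=> //; last first.
    by move=> w _; rewrite (le_trans qr)// lerDr sqrtr_ge0.
  by rewrite setCT [X in (X <= _)%E](_ : _ = 0%E) ?lee_fin ?expR_ge0//; exact: measure0.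
pose D := q - b * r.
have D0 : 0 < D by rewrite /D subr_gt0.
pose lam := r / (b * D).
have lam0 : 0 < lam by rewrite divr_gt0// mulr_gt0.
pose c := lam * b ^+ 2.
(* This value gives [lam / (1 + c) * v - L = lam * D ^+ 2], so the Chernoff bound reads
   [D ^+ 2 <= S]. *)
have cE : 1 + c = q / D.
  rewrite /c /lam /D; field.
  by apply/andP; split; apply/eqP; rewrite /D in D0; lra.
have q0 : 0 < q by lra.
have c10 : 0 < 1 + c by rewrite cE divr_gt0.
have bY l : l \in s -> bounded_measurable (fun w => g (Y l w)).
  by move=> ls; exact: bounded_measurable_comp bg (mY l ls).
have bg2 : bounded_measurable (fun z => - (lam * g z ^+ 2)).
  apply: bounded_measurableN; apply: bounded_measurableZ.
  exact: bounded_measurableX.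
have H := @chernoff_independent _ _ _ _ _ P I s Y (fun=> fun z => - (lam * g z ^+ 2))
  (fun l => - (lam / (1 + c) * \int[P]_w g (Y l w) ^+ 2))
  L us mY indep (fun=> bg2).
apply: (holds_except_sub _ (lexx _) (H _)).
- move=> w; rewrite !sumrN -!mulr_sumr -/v.
  set S := \sum_(l <- s) _ => Hw.
  have S0 : 0 <= S by apply: sumr_ge0 => *; exact: sqr_ge0.
  suff : D <= Num.sqrt S by rewrite /D; lra.
  rewrite -(ler_sqr (ltW D0) (sqrtr_ge0 _)) sqr_sqrtr//.
  rewrite -(ler_pM2l lam0).
  suff -> : lam * D ^+ 2 = lam / (1 + c) * v - L by lra.
  rewrite cE -q2 -r2 /lam /D; field.
  by apply/and3P; split; apply/eqP; rewrite /D in D0; lra.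
- move=> l ls; have bl2 := bounded_measurableX 2 (bY l ls).
  have b1 := @bounded_measurable_cst _ T R 1.
  have bZ := bounded_measurableZ (lam / (1 + c)) bl2.
  rewrite (le_trans _ (expR_ge1Dx _))//.
  rewrite -[X in _ <= X - _](expect_cst P) -expectZ// -expectB//.
  apply: le_expect.
  + apply: bounded_measurable_expR; apply: bounded_measurableN.
    exact: bounded_measurableZ.
  + apply: bounded_measurableB; first exact: bounded_measurable_cst.
    exact: bounded_measurableZ.
  move=> w; rewrite [X in 1 - X](_ : _ = lam * g (Y l w) ^+ 2 / (1 + c));
    last by ring.
  apply: expRN_le.
    by rewrite mulr_ge0 ?sqr_ge0// ltW.
  rewrite /c ler_pM2l// -[g _ ^+ 2]real_normK ?num_real//.
  by rewrite lerXn2r ?nnegrE// ltW.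
Qed.

(** After division by [c] the squares lie in [[0, 1/2]], where [expR x <= 1 + 2 * x]. The factor 2
    is affordable because this tail serves only to bound the size of [psi_hat]. *)
Lemma sum_square_upper_tail {d dZ} {T : measurableType d}
    {Z : measurableType dZ} {R : realType} (P : probability T R)
    {I : choiceType} (s : seq I) (Y : I -> T -> Z) (g : Z -> R) (c L : R) :
  uniq s -> {in s, forall l, measurable_fun setT (Y l)} ->
  independent_on P s Y -> bounded_measurable g ->
  (forall z, 2 * g z ^+ 2 <= c) -> 0 < c ->
  holds_except P (fun w => \sum_(l <- s) g (Y l w) ^+ 2
    <= 2 * (\sum_(l <- s) \int[P]_w g (Y l w) ^+ 2) + c * L) (expR (- L)).
Proof.
move=> us mY indep bg gc c0.
have ci0 : 0 < c^-1 by rewrite invr_gt0.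
have bg2 : bounded_measurable (fun z => c^-1 * g z ^+ 2).
  by apply: bounded_measurableZ; exact: bounded_measurableX.
have H := @chernoff_independent _ _ _ _ _ P I s Y (fun=> fun z => c^-1 * g z ^+ 2)
  (fun l => 2 * (c^-1 * \int[P]_w g (Y l w) ^+ 2)) L us mY indep (fun=> bg2).
apply: (holds_except_sub _ (lexx _) (H _)).
- move=> w; rewrite -!mulr_sumr => Hw.
  rewrite -(ler_pM2l ci0) (le_trans Hw)// mulrDr mulKf ?gt_eqF//.
  by rewrite mulrCA.
- move=> l ls.
  have bl2 : bounded_measurable (fun w => g (Y l w) ^+ 2).
    by apply: bounded_measurableX; exact: bounded_measurable_comp bg (mY l ls).
  have bcl := bounded_measurableZ c^-1 bl2.
  have b1 := @bounded_measurable_cst _ T R 1.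
  have bZ := bounded_measurableZ 2 bcl.
  rewrite (le_trans _ (expR_ge1Dx _))//.
  rewrite -[X in _ <= X + _](expect_cst P) -!expectZ// -expectD//.
  apply: le_expect.
  + exact: bounded_measurable_expR.
  + apply: bounded_measurableD; first exact: bounded_measurable_cst.
    exact: bounded_measurableZ.
  move=> w; apply: expR_le_linear; first by rewrite mulr_ge0 ?sqr_ge0// ltW.
  by rewrite mulrC ler_pdivrMr//; have := gc (Y l w); lra.
Qed.

Lemma holds_except_always {d} {T : measurableType d} {R : realType}
    (P : probability T R) (Q : T -> Prop) (e : R) :
  (forall w, Q w) -> 0 <= e -> holds_except P Q e.
Proof.
move=> HQ e0; exists setT; split=> //.
by rewrite setCT [X in (X <= _)%E](_ : _ = 0%E) ?lee_fin//; exact: measure0.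
Qed.

(** * Empirical Bernstein inequality *)

Lemma sqrt2_bounds {R : realType} :
  [/\ Num.sqrt 2 ^+ 2 = 2 :> R, 0 < Num.sqrt 2 :> R & Num.sqrt 2 <= 71 / 50 :> R].
Proof.
have s2 : Num.sqrt 2 ^+ 2 = 2 :> R by rewrite sqr_sqrtr.
have s0 : 0 < Num.sqrt 2 :> R by rewrite sqrtr_gt0.
by split=> //; rewrite -ler_sqr ?nnegrE ?s2; lra.
Qed.

(* [Y] is the absolute centred sum, [b] bounds the centred variables, [q ^+ 2]
   bounds their total second moment, and [V] is the sample variance. *)
Lemma empirical_bernstein_deterministic {R : realType} (Y n M b q V L : R) :
  0 <= Y -> 2 <= n -> 0 < M -> 0 < b -> b <= M -> 0 <= q -> 0 <= V -> 0 < L ->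
  q ^+ 2 <= n * (b * (M - b)) ->
  Y <= Num.sqrt (2 * L * q ^+ 2) + b * L / 3 ->
  q <= Num.sqrt ((n - 1) * V + Y ^+ 2 / n) + b * Num.sqrt L ->
  Y / n <= Num.sqrt V * Num.sqrt (2 * L / n) + 8 * M * L / (3 * (n - 1)).
Proof.
move=> Y0 n2 M0 b0 bM q0 V0 L0 H3 H1 H2.
have n0 : 0 < n by lra.
have n10 : 0 < n - 1 by lra.
have ML0 : 0 < M * L by exact: mulr_gt0.
suff : Y <= n * (Num.sqrt V * Num.sqrt (2 * L / n)) + 8 / 3 * (M * L).
  move=> H; rewrite ler_pdivrMr// (le_trans H)// [leRHS]mulrDl [n * _]mulrC lerD2l.
  rewrite [leRHS]mulrAC ler_pdivlMr ?mulr_gt0//.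
  by rewrite -[8 * M * L]mulrA; nra.
have [s2 s0 s142] := @sqrt2_bounds R.
set p := Num.sqrt 2 in s2 s0 s142.
set r := Num.sqrt L in H2.
have r2 : r ^+ 2 = L by rewrite sqr_sqrtr ?ltW.
have r0 : 0 < r by rewrite sqrtr_gt0.
have pr0 : 0 < p * r by exact: mulr_gt0.
have SV0 : 0 <= n * (Num.sqrt V * Num.sqrt (2 * L / n)).
  by rewrite !mulr_ge0 ?sqrtr_ge0// ltW.
(* In the remaining case [b * L / 3] is at most [Y / 8], so the Bernstein bound yields
   [7 / 8 * Y <= p * r * q]. *)
have [Ysmall|Ybig] := leP Y (8 / 3 * (M * L)); first lra.
have E1 : Num.sqrt (2 * L * q ^+ 2) = p * r * q.
  rewrite sqrtrM; last by rewrite mulr_ge0// ltW.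
  by rewrite sqrtrM// sqrtr_sqr ger0_norm.
rewrite E1 in H1.
(* [D] is the price of recentring at the sample mean, and [al] is the part of the sum of squares
   seen by the sample variance. *)
pose D := Y / Num.sqrt n.
have sn0 : 0 < Num.sqrt n by rewrite sqrtr_gt0.
have D0 : 0 <= D by rewrite divr_ge0// ltW.
have D2 : D ^+ 2 = Y ^+ 2 / n by rewrite expr_div_n sqr_sqrtr ?ltW.
pose al := Num.sqrt ((n - 1) * V).
have al0 : 0 <= al by exact: sqrtr_ge0.
have al2 : al ^+ 2 = (n - 1) * V by rewrite sqr_sqrtr// mulr_ge0// ltW.
have TT : Num.sqrt ((n - 1) * V + Y ^+ 2 / n) <= al + D.
  rewrite -ler_sqr ?nnegrE ?sqrtr_ge0 ?addr_ge0// sqr_sqrtr; last first.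
    by rewrite -al2 -D2 addr_ge0 ?sqr_ge0.
  by rewrite -al2 -D2 sqrrD; have := mulr_ge0 al0 D0; lra.
have bL : b * L <= M * L by rewrite ler_pM2r.
have bL0 : 0 < b * L by exact: mulr_gt0.
have YS : 7 / 8 * Y <= p * r * q by lra.
have YS2 : 49 / 64 * Y ^+ 2 <= 2 * L * (n * (b * (M - b))).
  apply: (@le_trans _ _ ((p * r * q) ^+ 2)).
    rewrite (_ : 49 / 64 * Y ^+ 2 = (7 / 8 * Y) ^+ 2); last by field.
    by rewrite ler_sqr// nnegrE; [lra | exact: mulr_ge0 (ltW pr0) q0].
  by rewrite 2!exprMn s2 r2 ler_pM2l// mulr_gt0.
have D2le : 49 / 64 * D ^+ 2 <= 2 * L * (b * (M - b)).
  rewrite D2 [leLHS]mulrA ler_pdivrMr// (le_trans YS2)//.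
  by rewrite le_eqVlt; apply/orP; left; apply/eqP; ring.
(* The square of the left side is at most [64 / 49 * L ^+ 2] times [4 * b * (M - b)], and the latter
   is [(2 * M - 3 / 2 * b) ^+ 2] minus [(2 * M - 5 / 2 * b) ^+ 2]. The slope 3/2 leaves a negative
   multiple of [b * L] to offset the other error terms. *)
have prD : p * r * D <= 8 / 7 * (L * (2 * M - 3 / 2 * b)).
  have c0 : 0 <= L * (2 * M - 3 / 2 * b) by rewrite mulr_ge0//; lra.
  rewrite -ler_sqr ?nnegrE; [|by rewrite mulr_ge0// ltW|lra].
  rewrite 2!exprMn s2 r2.
  apply: (@le_trans _ _ (64 / 49 * (L ^+ 2 * (4 * (b * (M - b)))))).
    have : L * (49 / 64 * D ^+ 2) <= L * (2 * L * (b * (M - b))) by rewrite ler_pM2l.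
    lra.
  have sq : 4 * (b * (M - b)) <= (2 * M - 3 / 2 * b) ^+ 2.
    have := sqr_ge0 (2 * M - 5 / 2 * b); nra.
  have : L ^+ 2 * (4 * (b * (M - b))) <= L ^+ 2 * (2 * M - 3 / 2 * b) ^+ 2.
    by rewrite ler_wpM2l// sqr_ge0.
  rewrite [in X in _ -> X]exprMn [(L * _) ^+ 2]exprMn; lra.
have pral : p * r * al <= n * (Num.sqrt V * Num.sqrt (2 * L / n)).
  rewrite -ler_sqr ?nnegrE//; last by rewrite mulr_ge0// ltW.
  rewrite 2!exprMn s2 r2 al2 !exprMn sqr_sqrtr// sqr_sqrtr; last first.
    by rewrite divr_ge0 ?ltW// mulr_gt0.
  have -> : n ^+ 2 * (V * (2 * L / n)) = 2 * L * (n * V).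
    by field; rewrite gt_eqF.
  by have := mulr_ge0 (ltW L0) V0; lra.
have Hq : p * r * q <= p * r * al + p * r * D + p * (b * L).
  have -> : p * (b * L) = p * r * (b * r) by rewrite -r2; ring.
  by rewrite -!mulrDr ler_pM2l// (le_trans H2)// lerD2r.
have pb : p * (b * L) <= 71 / 50 * (b * L) by rewrite ler_pM2r.
(* In total [M * L] has coefficient 16/7 and [b * L] has 71/50 + 1/3 - 12/7, which is below 1/20. As
   [b <= M], the sum stays below 8/3. *)
lra.
Qed.

Lemma sum_square_shift {R : realType} {I : Type} (s : seq I) (x : I -> R)
    (c : R) : (0 < size s)%N ->
  let mean := (\sum_(l <- s) x l) / (size s)%:R in
  \sum_(l <- s) (x l - c) ^+ 2
  = \sum_(l <- s) (x l - mean) ^+ 2 + (size s)%:R * (mean - c) ^+ 2.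
Proof.
move=> n0 mean.
have n0' : (size s)%:R != 0 :> R by rewrite pnatr_eq0 -lt0n.
have Sx : \sum_(l <- s) x l = (size s)%:R * mean by rewrite mulrC divfK.
have Sc (y : R) : \sum_(l <- s) y = (size s)%:R * y.
  by rewrite big_const_seq count_predT iter_addr addr0 mulr_natl.
have E (a : R) : \sum_(l <- s) (x l - a) ^+ 2
    = \sum_(l <- s) x l ^+ 2 - 2 * a * \sum_(l <- s) x l + (size s)%:R * a ^+ 2.
  rewrite -Sc mulr_sumr -sumrB -big_split; apply: eq_bigr => l _ /=; ring.
by rewrite !E Sx; ring.
Qed.

Lemma norm_sum_le {R : realType} {I : Type} (s : seq I) (x : I -> R) (c : R) :
  (forall l, `|x l| <= c) -> `|\sum_(l <- s) x l| <= (size s)%:R * c.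
Proof.
move=> xc; elim: s => [|l s IHs]; first by rewrite big_nil normr0 mul0r.
rewrite big_cons (le_trans (ler_normD _ _))// -natr1 mulrDl mul1r addrC.
exact: lerD.
Qed.

(** Three failure events are paid for: two Bernstein tails and the lower tail of the sum of squares.
    For a single sample both means lie in [[- M / 2, M / 2]], so the radius [M] is always valid. *)
Lemma empirical_bernstein {d dZ} {T : measurableType d}
    {Z : measurableType dZ} {R : realType} (P : probability T R)
    {I : choiceType} (s : seq I) (Y : I -> T -> Z) (h : Z -> R) (M L : R) :
  uniq s -> {in s, forall l, measurable_fun setT (Y l)} ->
  independent_on P s Y -> measurable_fun setT h ->
  (forall z, `|h z| <= M / 2) -> 0 < M -> 0 < L -> (0 < size s)%N ->
  let n : R := (size s)%:R in
  let mean w := (\sum_(l <- s) h (Y l w)) / n in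
  let var w := (\sum_(l <- s) (h (Y l w) - mean w) ^+ 2) / (n - 1) in
  holds_except P (fun w =>
    `|mean w - (\sum_(l <- s) \int[P]_x h (Y l x)) / n|
    <= if size s == 1%N then M
       else Num.sqrt (var w) * Num.sqrt (2 * L / n)
            + 8 * M * L / (3 * (n - 1))) (3 * expR (- L)).
Proof.
move=> us mY indep mh hM M0 L0 s0 n mean var.
have bh : bounded_measurable h by split=> //; exists (M / 2).
have bY l : l \in s -> bounded_measurable (fun w => h (Y l w)).
  by move=> ls; exact: bounded_measurable_comp bh (mY l ls).
have n0 : 0 < n by rewrite ltr0n.
have e0 := expR_ge0 (- L).
set m := (\sum_(l <- s) \int[P]_x h (Y l x)) / n.
have Eh l : l \in s -> `|\int[P]_x h (Y l x)| <= M / 2.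
  move=> ls; rewrite ler_norml -(expect_cst P (M / 2)) -mulN1r -expectZ; last first.
    exact: bounded_measurable_cst.
  have bM := @bounded_measurable_cst _ T R (M / 2).
  apply/andP; split; apply: le_expect => //; try exact: bY.
  - exact: bounded_measurableZ.
  - by move=> w; have := hM (Y l w); rewrite ler_norml; lra.
  - by move=> w; have := hM (Y l w); rewrite ler_norml; lra.
have mM : `|m| <= M / 2.
  rewrite /m normrM normfV (gtr0_norm n0) ler_pdivrMr// mulrC.
  rewrite big_seq_cond big_mkcond/=; apply: norm_sum_le => l.
  by rewrite andbT; case: ifP => [/Eh//|_]; rewrite normr0; lra.
have meanM w : `|mean w| <= M / 2.
  rewrite /mean normrM normfV (gtr0_norm n0) ler_pdivrMr// mulrC.
  exact: norm_sum_le.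
have [s1|s1] := eqVneq (size s) 1%N.
  apply: holds_except_always; last by rewrite mulr_ge0.
  move=> w; rewrite (le_trans (ler_normB _ _))//.
  by have := meanM w; lra.
have n2 : 2 <= n by rewrite ler_nat; case: (size s) s0 s1 => [|[]].
(* This [b] bounds [h - m], and [b * (M - b) = (M / 2) ^+ 2 - m ^+ 2] bounds the average second
   moment of [h - m]. *)
pose b := M / 2 + `|m|.
have b0 : 0 < b by rewrite ltr_pwDl// divr_gt0.
have bM : b <= M by rewrite /b; lra.
pose g z := h z - m.
have bg : bounded_measurable g.
  by apply: bounded_measurableB => //; exact: bounded_measurable_cst.
have gb z : `|g z| <= b by rewrite (le_trans (ler_normB _ _))// lerD2r.
pose q := Num.sqrt (\sum_(l <- s) \int[P]_w g (Y l w) ^+ 2).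
have Sq0 : 0 <= \sum_(l <- s) \int[P]_w g (Y l w) ^+ 2.
  by apply: sumr_ge0 => l _; apply: Rintegral_ge0 => *; exact: sqr_ge0.
have q0 : 0 <= q by exact: sqrtr_ge0.
have q2 : q ^+ 2 = \sum_(l <- s) \int[P]_w g (Y l w) ^+ 2 by rewrite sqr_sqrtr.
have Sc (y : R) : \sum_(l <- s) y = n * y.
  by rewrite big_const_seq count_predT iter_addr addr0 mulr_natl.
have SEh : \sum_(l <- s) \int[P]_x h (Y l x) = n * m by rewrite mulrC divfK ?gt_eqF.
have Eg : \sum_(l <- s) \int[P]_w g (Y l w) = 0.
  transitivity (\sum_(l <- s) (\int[P]_w h (Y l w) - m)).
    rewrite big_seq [RHS]big_seq; apply: eq_bigr => l ls.
    by rewrite expectB ?expect_cst//; [exact: bY|exact: bounded_measurable_cst].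
  by rewrite sumrB SEh Sc subrr.
have q2le : q ^+ 2 <= n * (b * (M - b)).
  rewrite q2.
  have -> : \sum_(l <- s) \int[P]_w g (Y l w) ^+ 2
      = \sum_(l <- s) (\int[P]_w (h (Y l w) ^+ 2)
          - 2 * m * \int[P]_w h (Y l w) + m ^+ 2).
    rewrite big_seq [RHS]big_seq; apply: eq_bigr => l ls.
    have b1 := bY l ls; have b2 := bounded_measurableX 2 b1.
    have b3 := bounded_measurableZ (2 * m) b1.
    have b4 := @bounded_measurable_cst _ T R (m ^+ 2).
    have b5 := bounded_measurableB b2 b3.
    rewrite -expectZ// -expectB// -(expect_cst P (m ^+ 2)) -expectD//.
    by apply: eq_Rintegral => w _; rewrite /g; ring.
  rewrite big_split sumrB/= -mulr_sumr SEh Sc.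
  have : \sum_(l <- s) \int[P]_w (h (Y l w) ^+ 2) <= n * (M / 2) ^+ 2.
    rewrite -Sc big_seq [leRHS]big_seq; apply: ler_sum => l ls.
    rewrite -(expect_cst P ((M / 2) ^+ 2)); apply: le_expect.
    - by apply: bounded_measurableX; exact: bY.
    - exact: bounded_measurable_cst.
    move=> w; rewrite -[h _ ^+ 2]real_normK ?num_real//.
    by rewrite ler_sqr ?nnegrE//; lra.
  have mm : m ^+ 2 = `|m| ^+ 2 by rewrite real_normK ?num_real.
  have -> : b * (M - b) = (M / 2) ^+ 2 - m ^+ 2 by rewrite mm /b; field.
  by lra.
have sumg w : \sum_(l <- s) g (Y l w) = n * (mean w - m).
  by rewrite /g sumrB Sc mulrBr [n * mean w]mulrC divfK ?gt_eqF.
have absg w : `|mean w - m| = `|\sum_(l <- s) g (Y l w)| / n.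
  by rewrite sumg normrM (gtr0_norm n0) mulrC mulKf ?gt_eqF.
have var0 w : 0 <= var w.
  by rewrite divr_ge0 ?sumr_ge0//; [move=> *; exact: sqr_ge0|lra].
have Tsq w : \sum_(l <- s) g (Y l w) ^+ 2
    = (n - 1) * var w + `|\sum_(l <- s) g (Y l w)| ^+ 2 / n.
  rewrite /g (sum_square_shift (fun l => h (Y l w)) m s0)/= -/n -/(mean w).
  have := sumg w; rewrite /g => ->.
  rewrite real_normK ?num_real// [(n - 1) * _]mulrC /var divfK; last first.
    by rewrite gt_eqF//; lra.
  by congr (_ + _); field; rewrite gt_eqF.
have two (v : R) : 0 < v -> q ^+ 2 <= v ->
    holds_except P (fun w => `|\sum_(l <- s) g (Y l w)|
      <= Num.sqrt (2 * L * v) + b * L / 3) (expR (- L) + expR (- L)).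
  move=> v0; rewrite q2 => qv.
  have := bernstein us mY indep bg.1 gb b0 v0 L0 Eg qv.
  have NEg : \sum_(l <- s) \int[P]_w - g (Y l w) = 0.
    transitivity (\sum_(l <- s) - \int[P]_w g (Y l w));
      last by rewrite sumrN Eg oppr0.
    rewrite big_seq [RHS]big_seq; apply: eq_bigr => l ls.
    under eq_Rintegral do rewrite -mulN1r.
    by rewrite expectZ ?mulN1r//; exact: bounded_measurable_comp bg (mY l ls).
  have Nqv : \sum_(l <- s) \int[P]_w (- g (Y l w)) ^+ 2 <= v.
    by under eq_bigr do under eq_Rintegral do rewrite sqrrN.
  have Ngb z : `|- g z| <= b by rewrite normrN.
  have := bernstein us mY indep (bounded_measurableN bg).1 Ngb b0 v0 L0 NEg Nqv.
  move=> /[swap] /holds_except_and/[apply]; apply: holds_except_sub => // w [].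
  by rewrite sumrN ler_norml => ? ?; apply/andP; split; lra.
have e3 : 3 * expR (- L) = expR (- L) + expR (- L) + expR (- L) by ring.
(* For small [q] the variance proxy [M ^+ 2 * L] already gives [(Num.sqrt 2 + 1 / 3) * M * L],
   within the 8/3 term alone. Otherwise [q ^+ 2] is positive, as [bernstein] requires of its
   proxy. *)
have [q2L|q2L] := leP (q ^+ 2) (M ^+ 2 * L).
  have ML0 : 0 < M ^+ 2 * L by rewrite mulr_gt0// exprn_gt0.
  have := two _ ML0 q2L; apply: holds_except_sub; last by rewrite e3; lra.
  move=> w; rewrite absg.
  have -> : 2 * L * (M ^+ 2 * L) = 2 * (L * M) ^+ 2 by ring.
  have LM0 : 0 < L * M by exact: mulr_gt0.
  rewrite sqrtrM// sqrtr_sqr (gtr0_norm LM0) => H.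
  apply: (@le_trans _ _ (8 * M * L / (3 * (n - 1)))); last first.
    by rewrite lerDr mulr_ge0 ?sqrtr_ge0.
  have [_ _ s142] := @sqrt2_bounds R.
  have H1 : Num.sqrt 2 * (L * M) <= 71 / 50 * (L * M) by rewrite ler_pM2r.
  have H2 : b * L <= M * L by rewrite ler_pM2r.
  rewrite ler_pdivrMr// (le_trans H)// [leRHS]mulrAC ler_pdivlMr; last first.
    by rewrite mulr_gt0//; lra.
  apply: (@le_trans _ _ (8 / 3 * (L * M) * (3 * (n - 1)))).
    by rewrite ler_wpM2r//; lra.
  by rewrite -[8 * M * L]mulrA [M * L]mulrC; nra.
have q2gt0 : 0 < q ^+ 2.
  by apply: le_lt_trans q2L; rewrite mulr_ge0 ?sqr_ge0// ltW.
have := two _ q2gt0 (lexx _).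
move=> /holds_except_and/(_ (sum_square_lower_tail us mY indep bg.1 gb b0 L0)).
rewrite -e3; apply: holds_except_sub => // w [H1 H2].
rewrite absg; apply: (empirical_bernstein_deterministic (b := b) (q := q)) => //.
by rewrite -Tsq.
Qed.

(** * Conditional expectations and the loss difference *)

(** Truncation turns the almost sure bound on the response into one that holds everywhere, as
    [bounded_measurable] demands. *)
Definition clip {R : realType} (c y : R) : R := Num.max (- c) (Num.min c y).

Lemma clip_norm {R : realType} (c y : R) : 0 <= c -> `|clip c y| <= c.
Proof.
move=> c0; rewrite ler_norml /clip le_max lexx/= ge_max ge_min lexx/= andbT.
lra.
Qed.

Lemma clip_id {R : realType} (c y : R) : `|y| <= c -> clip c y = y.
Proof. by rewrite ler_norml => /andP[? ?]; rewrite /clip min_r// max_r. Qed.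

Lemma measurable_clip {d} {T : measurableType d} {R : realType} (c : R)
    (f : T -> R) : measurable_fun setT f ->
  measurable_fun setT (fun x => clip c (f x)).
Proof.
move=> mf; apply: measurable_maxr; first exact: measurable_cst.
by apply: measurable_minr => //; exact: measurable_cst.
Qed.

Lemma bounded_measurable_clip {d} {T : measurableType d} {R : realType} (c : R)
    (f : T -> R) : 0 <= c -> measurable_fun setT f ->
  bounded_measurable (fun x => clip c (f x)).
Proof.
move=> c0 mf; split; first exact: measurable_clip.
by exists c => x; exact: clip_norm.
Qed.

Lemma integral_set_indic {d} {T : measurableType d} {R : realType}
    (P : probability T R) (A : set T) (f : T -> R) :
  (\int[P]_(x in A) (f x)%:E = \int[P]_x (f x * \1_A x)%:E)%E.
Proof.
rewrite integral_mkcond; apply: eq_integral => x _.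
rewrite patchE indicE; case: ifP => _; first by rewrite mulr1.
by rewrite mulr0.
Qed.

(** Test on the set where [f] exceeds [c]: the integral of the positive function [f - c] over it is
    at most 0, so that set is null. *)
Lemma ae_le_of_set_integrals {d} {T : measurableType d} {R : realType}
    (P : probability T R) (f : T -> R) (c : R) :
  measurable_fun setT f -> P.-integrable setT (EFin \o f) ->
  (forall A, measurable A -> (\int[P]_(x in A) (f x)%:E <= c%:E * P A)%E) ->
  {ae P, forall x, f x <= c}.
Proof.
move=> mf If Hf.
pose A := [set x | c < f x].
have mA : measurable A.
  rewrite -[A]setTI.
  have := mf measurableT `]c, +oo[%classic (measurable_itv _).
  by congr measurable; apply/seteqP; split=> w; rewrite /= in_itv/= andbT.
have IfA : P.-integrable A (EFin \o f) by apply: integrableS If.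
have IcA : P.-integrable A (EFin \o (fun=> c)).
  by apply: (@integrableS _ _ _ _ setT) => //; apply: bounded_integrable;
    exact: bounded_measurable_cst.
have mfc : measurable_fun A (EFin \o (fun x => f x - c)).
  apply/measurable_EFinP; apply: measurable_funB => //.
  exact: measurable_funS mf.
have int0 : (\int[P]_(x in A) `|(f x - c)%:E| = 0)%E.
  apply/eqP; rewrite eq_le; apply/andP; split; last first.
    by apply: integral_ge0 => x _; exact: abse_ge0.
  have -> : (\int[P]_(x in A) `|(f x - c)%:E| = \int[P]_(x in A) (f x - c)%:E)%E.
    apply: eq_integral => x /[!inE] Ax.
    by rewrite gee0_abs// lee_fin subr_ge0 ltW.
  rewrite (integralB_EFin mA IfA IcA)/= integral_cst//=.
  rewrite sube_le0; exact: Hf.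
have [H _] := ae_eq_integral_abs P mA mfc.
have := H int0; apply: filterS => x /= H'.
rewrite leNgt; apply/negP => cx.
have E : (f x - c)%:E = 0%:E by exact: H' cx.
by move: cx; rewrite -subr_gt0 (EFin_inj E) ltxx.
Qed.

(** Both bounds on [f] come from comparing its integrals over sets with those of the clipped
    response. The defining identity on sets then extends to bounded test functions through weighted
    laws. *)
Lemma cond_exp_bounded_version {d} {X : measurableType d} {R : realType}
    (P : probability X R) (Q : probability (X * R)%type R) (f : X -> R) (c : R) :
  0 <= c ->
  {ae Q, forall w, `|w.2| <= c} ->
  (forall A : set X, measurable A -> Q (A `*` setT) = P A) ->
  cond_exp_y P Q f ->
  {ae P, forall x, f x = clip c (f x)} /\
  forall phi, bounded_measurable phi ->
    \int[Q]_w (clip c w.2 * phi w.1) = \int[P]_x (clip c (f x) * phi x).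
Proof.
move=> c0 Qc marg [mf [If Ef]].
have mAT (A : set X) : measurable A -> measurable (A `*` (setT : set R)).
  by move=> mA; exact: measurableX.
have m2 : measurable_fun setT (fun w : X * R => w.2) by exact: measurable_snd.
have m1 : measurable_fun setT (fun w : X * R => w.1) by exact: measurable_fst.
pose y (w : X * R) := clip c w.2.
have by_ : bounded_measurable y by exact: bounded_measurable_clip.
have Ey A : measurable A ->
    (\int[P]_(x in A) (f x)%:E = \int[Q]_(w in A `*` setT) (y w)%:E)%E.
  move=> mA; rewrite -Ef//; apply: ae_eq_integral => //.
  - exact: mAT.
  - by apply/measurable_EFinP; exact: measurable_funS m2.
  - by apply/measurable_EFinP; exact: measurable_funS by_.1.
  by move: Qc; apply: filterS => w /= wc _; rewrite /y clip_id.
have law1 A : measurable A -> Q ((fun w : X * R => w.1) @^-1` A) = P A.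
  move=> mA; rewrite -marg//; congr (Q _).
  by apply/seteqP; split=> w //= [].
have Ey1 A : measurable A -> \int[Q]_w (y w * \1_A w.1) = fine (\int[P]_(x in A) (f x)%:E).
  move=> mA; rewrite Ey// integral_set_indic /Rintegral.
  congr fine; apply: eq_integral => w _.
  by rewrite !indicE in_setX in_setT andbT.
have b1 A : measurable A -> bounded_measurable (fun w : X * R => \1_A w.1 : R).
  by move=> mA; apply: bounded_measurable_comp m1; exact: bounded_measurable_indic.
have E1 A : measurable A -> \int[Q]_w (\1_A w.1 : R) = fine (P A).
  move=> mA; rewrite -expect_indic//.
  by apply: expect_law => //; exact: bounded_measurable_indic.
have finA A : measurable A -> (\int[P]_(x in A) (f x)%:E)%E \is a fin_num.
  move=> mA; apply: integrable_fin_num => //.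
  exact: integrableS If.
have yc w : `|y w| <= c by exact: clip_norm.
have up : {ae P, forall x, f x <= c}.
  apply: ae_le_of_set_integrals => // A mA.
  rewrite -(fineK (finA _ mA)) -Ey1// -[P A]fineK ?fin_num_measure// -EFinM lee_fin.
  rewrite -E1// -expectZ; last exact: b1.
  apply: le_expect.
  - exact: bounded_measurableM (b1 _ mA).
  - exact: bounded_measurableZ (b1 _ mA).
  move=> w; rewrite ler_wpM2r ?indicE ?ler0n//.
  by have := yc w; rewrite ler_norml => /andP[].
have lo : {ae P, forall x, - f x <= c}.
  apply: ae_le_of_set_integrals => [||A mA].
  - exact: measurableT_comp.
  - by have := integrableN If; apply: eq_integrable.
  under eq_integral do rewrite EFinN.
  rewrite integralN/=; last first.
    by apply: integrable_add_def => //; exact: integrableS If.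
  rewrite -(fineK (finA _ mA)) -Ey1// -[P A]fineK ?fin_num_measure// -EFinM.
  rewrite -EFinN lee_fin lerNl -mulNr -E1// -expectZ; last exact: b1.
  apply: le_expect.
  - exact: bounded_measurableZ (b1 _ mA).
  - exact: bounded_measurableM (b1 _ mA).
  move=> w; rewrite ler_wpM2r ?indicE ?ler0n//.
  by have := yc w; rewrite ler_norml => /andP[].
have fc : {ae P, forall x, f x = clip c (f x)}.
  near=> x; rewrite clip_id// ler_norml lerNl.
  by apply/andP; split; near: x.
split=> // phi bphi.
pose g x := clip c (f x).
have bg : bounded_measurable g by exact: bounded_measurable_clip.
have gc x : `|g x| <= c by exact: clip_norm.
have Eg A : measurable A -> \int[Q]_w (y w * \1_A w.1) = \int[P]_x (g x * \1_A x).
  move=> mA; rewrite Ey1// /Rintegral -integral_set_indic; congr fine.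
  apply: ae_eq_integral => //.
  - by apply/measurable_EFinP; exact: measurable_funS mf.
  - by apply/measurable_EFinP; exact: measurable_funS bg.1.
  by move: fc; apply: filterS => x /= fx _; rewrite /g -fx.
have [mphi [C phiC]] := bphi.
have C0 x : 0 <= phi x + C by have := phiC x; rewrite ler_norml; lra.
have bC := @bounded_measurable_cst _ X R C.
have bcX := @bounded_measurable_cst _ X R c.
have bcQ := @bounded_measurable_cst _ (X * R)%type R c.
have bphiC := bounded_measurableD bphi bC.
have byc := bounded_measurableD by_ bcQ.
have bgc := bounded_measurableD bg bcX.
have b1phi : bounded_measurable (fun w : X * R => phi w.1).
  exact: bounded_measurable_comp bphi m1.
have b1phiC : bounded_measurable (fun w : X * R => phi w.1 + C).
  exact: bounded_measurable_comp bphiC m1.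
(* The shifts by [c] and [C] make weights and test function nonnegative; the extra terms are
   expanded and cancelled below. *)
have : (\int[Q]_w ((y w + c) * (phi w.1 + C))%:E
    = \int[P]_x ((g x + c) * (phi x + C))%:E)%E.
  apply: (@integral_weighted_law _ _ _ _ _ _ _ Q P (fun w => y w + c)
    (fun x => g x + c) (fun w => w.1) id (fun x => phi x + C)) => //.
  - exact: byc.1.
  - exact: bgc.1.
  - by move=> w; have := yc w; rewrite ler_norml; lra.
  - by move=> w; have := gc w; rewrite ler_norml; lra.
  - exact: bphiC.1.
  move=> A mA; have bA := b1 _ mA.
  have bA' := @bounded_measurable_indic _ X R _ mA.
  rewrite !EFin_Rintegral; [|exact: bounded_measurableM|exact: bounded_measurableM].
  congr _%:E; transitivity (\int[Q]_w (y w * \1_A w.1 + c * \1_A w.1)).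
    by apply: eq_Rintegral => w _; rewrite mulrDl.
  transitivity (\int[P]_x (g x * \1_A x + c * \1_A x)); last first.
    by apply: eq_Rintegral => w _; rewrite mulrDl.
  have t1 := bounded_measurableM by_ bA; have t2 := bounded_measurableM bg bA'.
  have t3 := bounded_measurableZ c bA; have t4 := bounded_measurableZ c bA'.
  by rewrite !expectD// !expectZ// Eg// E1// expect_indic.
rewrite !EFin_Rintegral; [|exact: bounded_measurableM|exact: bounded_measurableM].
move=> /(congr1 fine)/=.
have t1 := bounded_measurableM by_ b1phi; have t2 := bounded_measurableM bg bphi.
have t3 := bounded_measurableZ C by_; have t4 := bounded_measurableZ C bg.
have t5 := bounded_measurableZ c b1phiC; have t6 := bounded_measurableZ c bphiC.
have t7 := bounded_measurableD t1 t3; have t8 := bounded_measurableD t2 t4.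
have -> : \int[Q]_w ((y w + c) * (phi w.1 + C))
    = \int[Q]_w (y w * phi w.1 + C * y w + c * (phi w.1 + C)).
  by apply: eq_Rintegral => w _; ring.
have -> : \int[P]_x ((g x + c) * (phi x + C))
    = \int[P]_x (g x * phi x + C * g x + c * (phi x + C)).
  by apply: eq_Rintegral => w _; ring.
rewrite !expectD// !expectZ//.
have -> : \int[Q]_w (phi w.1 + C) = \int[P]_x (phi x + C).
  exact: (expect_law m1 law1 bphiC).
have -> : \int[Q]_w y w = \int[P]_x g x.
  have := Eg setT measurableT.
  by under eq_Rintegral do rewrite indicT mulr1;
    under [in X in _ = X -> _]eq_Rintegral do rewrite indicT mulr1.
by move=> H; lra.
Unshelve. all: by end_near.
Qed.

(** * The L2 seminorm and the loss difference *)

Lemma normP_ge0 {d} {X : measurableType d} {R : realType}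
    (P : probability X R) (f : X -> R) : 0 <= normP P f.
Proof. exact: sqrtr_ge0. Qed.

Lemma normP_sqr {d} {X : measurableType d} {R : realType}
    (P : probability X R) (f : X -> R) :
  normP P f ^+ 2 = \int[P]_x (f x ^+ 2).
Proof. by rewrite sqr_sqrtr//; apply: Rintegral_ge0 => x _; exact: sqr_ge0. Qed.

Lemma normP_ae_eq {d} {X : measurableType d} {R : realType}
    (P : probability X R) (f g : X -> R) :
  measurable_fun setT f -> measurable_fun setT g ->
  {ae P, forall x, f x = g x} -> normP P f = normP P g.
Proof.
move=> mf mg fg; congr (Num.sqrt (fine _)); apply: ae_eq_integral => //.
- by apply/measurable_EFinP; exact: measurable_funX.
- by apply/measurable_EFinP; exact: measurable_funX.
by move: fg; apply: filterS => x /= ->.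
Qed.

Lemma cauchy_schwarz_normP {d} {X : measurableType d} {R : realType}
    (P : probability X R) (f g : X -> R) :
  bounded_measurable f -> bounded_measurable g ->
  `|\int[P]_x (f x * g x)| <= normP P f * normP P g.
Proof.
move=> bf bg; set c := \int[P]_x (f x * g x).
have bfg := bounded_measurableM bf bg.
have bf2 := bounded_measurableX 2 bf; have bg2 := bounded_measurableX 2 bg.
(* The integral of [(s * f - r * g) ^+ 2] is nonnegative. Below, [s = b] and [r = c] give the
   inequality when [b] is nonzero; if [b = 0], a large [r] forces [c = 0]. *)
have key (s r : R) : 0 <= s ^+ 2 * normP P f ^+ 2 - 2 * s * r * c + r ^+ 2 * normP P g ^+ 2.
  rewrite !normP_sqr.
  have e1 := bounded_measurableZ (s ^+ 2) bf2.
  have e2 := bounded_measurableZ (2 * s * r) bfg.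
  have e3 := bounded_measurableZ (r ^+ 2) bg2.
  have e4 := bounded_measurableB e1 e2.
  rewrite /c -!expectZ// -expectB// -expectD//; apply: Rintegral_ge0 => x _.
  rewrite (_ : _ - _ + _ = (s * f x - r * g x) ^+ 2) ?sqr_ge0//; ring.
rewrite -ler_sqr ?nnegrE ?mulr_ge0 ?normP_ge0// real_normK ?num_real// exprMn.
have a0 := sqr_ge0 (normP P f); have b0 := sqr_ge0 (normP P g).
move: (normP P f ^+ 2) (normP P g ^+ 2) a0 b0 key => a b a0 b0 key.
have [b00|bn0] := eqVneq b 0.
  have [-> |c0] := eqVneq c 0; first by rewrite expr0n/= mulr_ge0.
  have := key 1 ((a + 1) / (2 * c)).
  rewrite b00 mulr0 addr0 expr1n mul1r mulr1.
  have -> : 2 * ((a + 1) / (2 * c)) * c = a + 1 by field.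
  by lra.
have bp : 0 < b by rewrite lt_def bn0.
by have := key b c; move=> K; rewrite -(ler_pM2l bp); lra.
Qed.

Lemma normP_triangle {d} {X : measurableType d} {R : realType}
    (P : probability X R) (f g : X -> R) :
  bounded_measurable f -> bounded_measurable g ->
  normP P (fun x => f x - g x) <= normP P f + normP P g.
Proof.
move=> bf bg.
rewrite -ler_sqr ?nnegrE ?addr_ge0 ?normP_ge0// sqrrD !normP_sqr.
have bfg := bounded_measurableM bf bg.
have bf2 := bounded_measurableX 2 bf; have bg2 := bounded_measurableX 2 bg.
have b2 := bounded_measurableZ 2 bfg; have b3 := bounded_measurableB bf2 b2.
have -> : \int[P]_x ((f x - g x) ^+ 2)
    = \int[P]_x (f x ^+ 2 - 2 * (f x * g x) + g x ^+ 2).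
  by apply: eq_Rintegral => x _; ring.
rewrite expectD// expectB// expectZ//.
have := cauchy_schwarz_normP P bf bg; rewrite ler_norml => /andP[H _].
by rewrite mulr2n; lra.
Qed.

(** The factored form exposes [f1 - f2], which makes the second moment proportional to its squared
    norm, and is affine in the clipped response. *)
Definition loss_diff {X : Type} {R : realType} (c : R) (f1 f2 : X -> R)
    (z : X * R) : R :=
  (f1 z.1 - f2 z.1) * (f1 z.1 + f2 z.1 - 2 * clip c z.2).

Lemma loss_diffE {X : Type} {R : realType} (c : R) (f1 f2 : X -> R) (z : X * R) :
  `|z.2| <= c -> loss_diff c f1 f2 z = sqloss f1 z - sqloss f2 z.
Proof. by move=> zc; rewrite /loss_diff clip_id// /sqloss; ring. Qed.

Lemma measurable_loss_diff {d} {X : measurableType d} {R : realType} (c : R)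
    (f1 f2 : X -> R) :
  measurable_fun setT f1 -> measurable_fun setT f2 ->
  measurable_fun setT (loss_diff c f1 f2).
Proof.
move=> m1 m2.
have n1 : measurable_fun setT (fun z : X * R => f1 z.1).
  by apply: measurableT_comp m1 _; exact: measurable_fst.
have n2 : measurable_fun setT (fun z : X * R => f2 z.1).
  by apply: measurableT_comp m2 _; exact: measurable_fst.
apply: measurable_funM; first exact: measurable_funB.
apply: measurable_funB; first exact: measurable_funD.
apply: measurable_funM; first exact: measurable_cst.
by apply: measurable_clip; exact: measurable_snd.
Qed.

Lemma loss_diff_sqr_le {X : Type} {R : realType} (c : R) (f1 f2 : X -> R)
    (z : X * R) :
  (forall x, `|f1 x| <= c) -> (forall x, `|f2 x| <= c) -> 0 <= c ->
  loss_diff c f1 f2 z ^+ 2 <= 16 * c ^+ 2 * (f1 z.1 - f2 z.1) ^+ 2.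
Proof.
move=> f1c f2c c0; rewrite /loss_diff exprMn mulrC ler_wpM2r ?sqr_ge0//.
have := f1c z.1; have := f2c z.1; have := clip_norm z.2 c0.
rewrite !ler_norml => /andP[? ?] /andP[? ?] /andP[? ?].
have -> : 16 * c ^+ 2 = (4 * c) ^+ 2 by ring.
rewrite -[leLHS]real_normK ?num_real// ler_sqr ?nnegrE//; last lra.
by rewrite ler_norml; apply/andP; split; lra.
Qed.

(** As a difference of two squares, each in [[0, 4 * c ^+ 2]], it is bounded by [4 * c ^+ 2], half
    of what the product of the two factor bounds gives. This is [M / 2] for [M = 8 * c ^+ 2]. *)
Lemma loss_diff_norm_le {X : Type} {R : realType} (c : R) (f1 f2 : X -> R)
    (z : X * R) :
  (forall x, `|f1 x| <= c) -> (forall x, `|f2 x| <= c) ->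
  `|loss_diff c f1 f2 z| <= 8 * c ^+ 2 / 2.
Proof.
move=> f1c f2c; have c0 : 0 <= c := le_trans (normr_ge0 _) (f1c z.1).
have := f1c z.1; have := f2c z.1; have := clip_norm z.2 c0.
rewrite /loss_diff; move: (clip _ _) (f1 _) (f2 _) => y a b.
rewrite !ler_norml => /andP[? ?] /andP[? ?] /andP[? ?].
have sq (x : R) : - (2 * c) <= x -> x <= 2 * c -> 0 <= (2 * c - x) * (2 * c + x).
  by move=> ? ?; apply: mulr_ge0; lra.
have ha : 0 <= (2 * c - (a - y)) * (2 * c + (a - y)) by apply: sq; lra.
have hb : 0 <= (2 * c - (b - y)) * (2 * c + (b - y)) by apply: sq; lra.
by have := sqr_ge0 (a - y); have := sqr_ge0 (b - y); move=> *; apply/andP; split; lra.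
Qed.

(** The response enters linearly, so testing against [f1 - f2] replaces it by the regression
    function [g]. *)
Lemma expect_loss_diff {d} {X : measurableType d} {R : realType}
    (P : probability X R) (Q : probability (X * R)%type R) (c : R)
    (f1 f2 g : X -> R) :
  0 <= c -> bounded_measurable f1 -> bounded_measurable f2 ->
  bounded_measurable g ->
  (forall A : set X, measurable A -> Q (A `*` setT) = P A) ->
  (forall phi, bounded_measurable phi ->
    \int[Q]_w (clip c w.2 * phi w.1) = \int[P]_x (g x * phi x)) ->
  \int[Q]_w loss_diff c f1 f2 w
  = normP P (fun x => f1 x - g x) ^+ 2 - normP P (fun x => f2 x - g x) ^+ 2.
Proof.
move=> c0 b1 b2 bg marg Hg.
have m2 : measurable_fun setT (fun w : X * R => w.2) by exact: measurable_snd.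
have m1 : measurable_fun setT (fun w : X * R => w.1) by exact: measurable_fst.
have by_ : bounded_measurable (fun w : X * R => clip c w.2).
  exact: bounded_measurable_clip.
have law1 A : measurable A -> Q ((fun w : X * R => w.1) @^-1` A) = P A.
  move=> mA; rewrite -marg//; congr (Q _).
  by apply/seteqP; split=> w //= [].
have bd := bounded_measurableB b1 b2.
have bs := bounded_measurableM bd (bounded_measurableD b1 b2).
have bd1 := bounded_measurable_comp bd m1.
have bs1 := bounded_measurable_comp bs m1.
have bdy := bounded_measurableZ 2 (bounded_measurableM by_ bd1).
have bgd := bounded_measurableM bg bd.
have bgd2 := bounded_measurableZ 2 bgd.
transitivity (\int[P]_x ((f1 x - f2 x) * (f1 x + f2 x))
    - 2 * \int[P]_x (g x * (f1 x - f2 x))).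
  rewrite -(expect_law m1 law1 bs) -(Hg _ bd) -expectZ; last first.
    exact: bounded_measurableM.
  rewrite -expectB//.
  by apply: eq_Rintegral => w _; rewrite /loss_diff; ring.
rewrite !normP_sqr.
have e1 := bounded_measurableX 2 (bounded_measurableB b1 bg).
have e2 := bounded_measurableX 2 (bounded_measurableB b2 bg).
rewrite -expectZ// -expectB// -expectB//.
by apply: eq_Rintegral => x _; ring.
Qed.

Lemma expect_loss_diff_sqr {d} {X : measurableType d} {R : realType}
    (P : probability X R) (Q : probability (X * R)%type R) (c : R)
    (f1 f2 : X -> R) :
  measurable_fun setT f1 -> measurable_fun setT f2 ->
  (forall x, `|f1 x| <= c) -> (forall x, `|f2 x| <= c) -> 0 <= c ->
  (forall A : set X, measurable A -> Q (A `*` setT) = P A) ->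
  \int[Q]_w (loss_diff c f1 f2 w ^+ 2)
  <= 16 * c ^+ 2 * normP P (fun x => f1 x - f2 x) ^+ 2.
Proof.
move=> mf1 mf2 f1c f2c c0 marg.
have b1 : bounded_measurable f1 by split=> //; exists c.
have b2 : bounded_measurable f2 by split=> //; exists c.
have m1 : measurable_fun setT (fun w : X * R => w.1) by exact: measurable_fst.
have law1 A : measurable A -> Q ((fun w : X * R => w.1) @^-1` A) = P A.
  move=> mA; rewrite -marg//; congr (Q _).
  by apply/seteqP; split=> w //= [].
have bd2 := bounded_measurableX 2 (bounded_measurableB b1 b2).
have bd21 := bounded_measurable_comp bd2 m1.
rewrite normP_sqr -(expect_law m1 law1 bd2) -expectZ//; apply: le_expect.
- apply: bounded_measurableX; split; first exact: measurable_loss_diff.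
  by exists (8 * c ^+ 2 / 2) => z; exact: loss_diff_norm_le.
- exact: bounded_measurableZ.
by move=> w; exact: loss_diff_sqr_le.
Qed.

(** The squares of [f1], [f2], [g] and [g'] cancel and leave [- 2] times the integral of
    [(f1 - f2) * (g - g')], to which Cauchy-Schwarz applies. *)
Lemma normP_sqr_diff_drift {d} {X : measurableType d} {R : realType}
    (P : probability X R) (f1 f2 g g' : X -> R) :
  bounded_measurable f1 -> bounded_measurable f2 ->
  bounded_measurable g -> bounded_measurable g' ->
  `|(normP P (fun x => f1 x - g x) ^+ 2 - normP P (fun x => f2 x - g x) ^+ 2)
    - (normP P (fun x => f1 x - g' x) ^+ 2 - normP P (fun x => f2 x - g' x) ^+ 2)|
  <= 2 * normP P (fun x => f1 x - f2 x) * normP P (fun x => g x - g' x).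
Proof.
move=> b1 b2 bg bg'.
have s1 := bounded_measurableX 2 (bounded_measurableB b1 bg).
have s2 := bounded_measurableX 2 (bounded_measurableB b2 bg).
have s3 := bounded_measurableX 2 (bounded_measurableB b1 bg').
have s4 := bounded_measurableX 2 (bounded_measurableB b2 bg').
have s12 := bounded_measurableB s1 s2; have s34 := bounded_measurableB s3 s4.
have bd := bounded_measurableB b1 b2; have bdg := bounded_measurableB bg bg'.
have bdd := bounded_measurableM bd bdg.
rewrite !normP_sqr -!expectB//.
have -> : \int[P]_x ((f1 x - g x) ^+ 2 - (f2 x - g x) ^+ 2
      - ((f1 x - g' x) ^+ 2 - (f2 x - g' x) ^+ 2))
    = \int[P]_x (- 2 * ((f1 x - f2 x) * (g x - g' x))).
  by apply: eq_Rintegral => x _; ring.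
rewrite expectZ// normrM normrN normr_nat -mulrA ler_pM2l//.
exact: cauchy_schwarz_normP.
Qed.

(** * The adaptive window *)

(** Oracle inequality of the Goldenshluger-Lepski rule. Windows up to [k] have bias at most [gam],
    so [phi_hat] at [k] is at most [2 * gam]. The definition of [phi_hat] compares [khat] and [k] at
    the longer of the two, and minimality of [khat] bounds the rest. Passing from the estimate at
    [k] to [m0] adds one radius and one [gam]. *)
Lemma arw_deviation {R : realType} (M delta' : R) (u : nat -> nat -> R)
    (B : nat -> nat) (t khat k : nat) (m : nat -> R) (m0 gam : R) :
  is_khat M delta' u B t khat -> (1 <= k <= t)%N ->
  (forall i, (1 <= i <= t)%N ->
    `|mu_hat u B t i - m i| <= psi_hat M delta' u B t i) ->
  (forall i, (1 <= i <= k)%N -> `|m i - m0| <= gam) ->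
  `|mu_hat u B t khat - m0| <= 3 * psi_hat M delta' u B t k + 5 * gam.
Proof.
move=> [/andP[kh1 kht] khmin] /andP[k1 kt] dev drift.
have Hmin := khmin k; rewrite k1 kt in Hmin; have {}Hmin := Hmin isT.
have gam0 : 0 <= gam by have := drift k; rewrite k1 leqnn => /(_ isT); apply: le_trans.
have dv i : (1 <= i)%N -> (i <= t)%N -> `|mu_hat u B t i - m i| <= psi_hat M delta' u B t i.
  by move=> i1 it; apply: dev; rewrite i1.
have phi0 i : 0 <= phi_hat M delta' u B t i by exact: bigmax_ge_id.
have phi_ge i j : (1 <= i)%N -> (i <= j)%N ->
    `|mu_hat u B t j - mu_hat u B t i|
    <= phi_hat M delta' u B t j + (psi_hat M delta' u B t j + psi_hat M delta' u B t i).
  move=> i1 ij; rewrite -lerBlDr /phi_hat.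
  apply: le_trans (le_bigmax_seq _ i _ _ _ _) => //.
    by rewrite le_max lexx.
  by rewrite mem_index_iota i1 ltnS.
have phik : phi_hat M delta' u B t k <= 2 * gam.
  rewrite /phi_hat big_nat_cond; apply: bigmax_le; first by rewrite mulr_ge0.
  move=> i /andP[/andP[i1 ik] _]; rewrite ge_max mulr_ge0// andbT lerBlDr.
  rewrite ltnS in ik; have it := leq_trans ik kt.
  have := dv k k1 kt; have := dv i i1 it.
  have := drift i; rewrite i1 ik => /(_ isT); have := drift k; rewrite k1 leqnn => /(_ isT).
  rewrite !ler_norml => /andP[? ?] /andP[? ?] /andP[? ?] /andP[? ?].
  by apply/andP; split; lra.
have diff : `|mu_hat u B t khat - mu_hat u B t k| <= 2 * (2 * gam + psi_hat M delta' u B t k).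
  have [kkh|khk] := leqP k khat.
    have := phi_ge _ _ k1 kkh; have := phi0 k; lra.
  have := phi_ge _ _ kh1 (ltnW khk); rewrite distrC; have := phi0 khat; lra.
have := dv k k1 kt; have := drift k; rewrite k1 leqnn => /(_ isT).
move: diff; rewrite !ler_norml => /andP[? ?] /andP[? ?] /andP[? ?].
by apply/andP; split; lra.
Qed.

(** A wrong choice forces the gap times [a1 + a2] below the deviation. If [a1 + a2 <= r] the gap is
    at most [r], which accounts for the [+ 1]; otherwise one divides by [a1 + a2], using that it
    dominates both [H] and [r]. *)
Lemma selection_bound {R : realType} (a1 a2 H b c r mu : R) :
  0 <= a1 -> 0 <= a2 -> 0 <= b -> 0 <= c -> 0 <= r -> 0 <= H -> H <= a1 + a2 ->
  `|mu - (a1 ^+ 2 - a2 ^+ 2)| <= H * b + c * H * r + c * r ^+ 2 ->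
  (if mu <= 0 then a1 else a2) - Num.min a1 a2 <= b + (2 * c + 1) * r.
Proof.
move=> a10 a20 b0 c0 r0 H0 Ha dev.
have RHS0 : 0 <= b + (2 * c + 1) * r by rewrite addr_ge0// mulr_ge0//; lra.
suff main : (if mu <= 0 then a1 - a2 else a2 - a1) <= b + (2 * c + 1) * r.
  by case: ifP main => _ main; rewrite /Num.min; case: ltP => _; rewrite ?subrr.
have crr : 0 <= c * r by exact: mulr_ge0.
have key (x : R) : x <= a1 + a2 -> x * (a1 + a2) <= H * b + c * H * r + c * r ^+ 2 ->
    x <= b + (2 * c + 1) * r.
  move=> xS xH; have [Sr|Sr] := leP (a1 + a2) r; first by nra.
  have S0 : 0 < a1 + a2 by exact: le_lt_trans Sr.
  rewrite -(ler_pM2r S0) (le_trans xH)//.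
  have h1 : H * b <= (a1 + a2) * b by rewrite ler_wpM2r.
  have h2 : H * (c * r) <= (a1 + a2) * (c * r) by rewrite ler_wpM2r.
  have h3 : c * r * r <= c * r * (a1 + a2) by rewrite ler_wpM2l// ltW.
  have h4 : 0 <= (a1 + a2) * r by rewrite mulr_ge0// ltW.
  lra.
move: dev; rewrite ler_norml => /andP[d1 d2].
by case: ifPn => [mu0|/negbTE mu0]; apply: key; first [lra | move/negbT: mu0; rewrite -ltNge => mu0; lra].
Qed.

(** One duplicate-free list of sample indices, so that the tail bounds for lists apply to a whole
    window. *)
Definition window (B : nat -> nat) (t k : nat) : seq (nat * nat) :=
  [seq (j, i) | j <- index_iota (t - k).+1 t.+1, i <- index_iota 0 (B j)].

Lemma big_window {V : Type} {idx : V} (op : Monoid.law idx) (B : nat -> nat)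
    (t k : nat) (F : nat -> nat -> V) :
  \big[op/idx]_((t - k).+1 <= j < t.+1) \big[op/idx]_(0 <= i < B j) F j i
  = \big[op/idx]_(l <- window B t k) F l.1 l.2.
Proof. by rewrite big_allpairs_dep. Qed.

Lemma size_window (B : nat -> nat) (t k : nat) : size (window B t k) = Btk B t k.
Proof.
rewrite -sum1_size -(big_window _ B t k (fun _ _ => 1%N)).
by apply: eq_bigr => j _; rewrite sum_nat_const_nat subn0 muln1.
Qed.

Lemma mem_window (B : nat -> nat) (t k : nat) (l : nat * nat) :
  (l \in window B t k) = ((t - k < l.1 <= t) && (l.2 < B l.1))%N.
Proof.
case: l => j i; apply/allpairsPdep/idP => /= [[j' [i' [+ + [-> ->]]]]|/andP[jt iB]].
  by rewrite !mem_index_iota ltnS => -> ->.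
by exists j, i; rewrite !mem_index_iota ltnS.
Qed.

Lemma uniq_window (B : nat -> nat) (t k : nat) : uniq (window B t k).
Proof.
apply: allpairs_uniq_dep; first exact: iota_uniq.
  by move=> j _; exact: iota_uniq.
by move=> [j i] [j' i'] _ _ /= [-> ->].
Qed.

Lemma independent_window {dO d} {Omega : measurableType dO}
    {Z : measurableType d} {R : realType} (Prob : probability Omega R)
    (z : nat -> nat -> Omega -> Z) (B : nat -> nat) (t k : nat) :
  batches_indep Prob z B t ->
  independent_on Prob (window B t k) (fun l => z l.1 l.2).
Proof.
move=> indep A mA.
(* Batches before the window are unconstrained and contribute factors equal to 1. *)
pose A' j i := if (t - k < j)%N then A (j, i) else setT.
have := indep A'; rewrite (_ : \bigcap_(j in _) _ =
    \bigcap_(l in [set l | l \in window B t k]) (z l.1 l.2 @^-1` A l)); last first.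
  apply/seteqP; split=> w /= Hw.
    move=> [j i] /=; rewrite mem_window/= => /andP[/andP[tj jt] iB].
    have j1 : (1 <= j <= t)%N by rewrite jt andbT; exact: leq_ltn_trans tj.
    by have := Hw j j1 i iB; rewrite /A' tj.
  move=> j /= /andP[j1 jt] i /= iB; rewrite /A'; case: ifP => // tj.
  by apply: (Hw (j, i)); rewrite /= mem_window/= tj jt iB.
move=> ->; last by move=> j i; rewrite /A'; case: ifP.
congr _%:E; rewrite (@big_cat_nat _ _ _ (t - k).+1)//=; last first.
  by rewrite ltnS leq_subr.
rewrite big_nat big1 ?mul1r => [|j /andP[_ jt]].
  rewrite big_allpairs_dep/=.
  by apply: eq_big_nat => j /andP[tj _]; apply: eq_bigr => i _; rewrite /A' tj.
rewrite big1// => i _; rewrite /A' ltnNge -ltnS jt/= preimage_setT.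
by rewrite [Prob _](probability_setT Prob).
Qed.

(** * Statistics of a window *)

Lemma mu_hat_window {R : realType} (u : nat -> nat -> R) (B : nat -> nat) (t k : nat) :
  mu_hat u B t k
  = (\sum_(l <- window B t k) u l.1 l.2) / (size (window B t k))%:R.
Proof. by rewrite /mu_hat big_window size_window. Qed.

Lemma v_hat_window {R : realType} (u : nat -> nat -> R) (B : nat -> nat) (t k : nat) :
  v_hat u B t k
  = Num.sqrt ((\sum_(l <- window B t k) (u l.1 l.2 - mu_hat u B t k) ^+ 2)
              / ((size (window B t k))%:R - 1)).
Proof.
by rewrite /v_hat (big_window _ B t k (fun j i => (u j i - _) ^+ 2)) size_window.
Qed.

(** Lets the observed losses be exchanged for the clipped [loss_diff] on the event where all
    responses are bounded. *)
Lemma psi_hat_ext {R : realType} (M delta' : R) (u u' : nat -> nat -> R)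
    (B : nat -> nat) (t k : nat) :
  {in window B t k, forall l, u l.1 l.2 = u' l.1 l.2} ->
  mu_hat u B t k = mu_hat u' B t k /\
  psi_hat M delta' u B t k = psi_hat M delta' u' B t k.
Proof.
move=> uu'.
have E : mu_hat u B t k = mu_hat u' B t k.
  by rewrite !mu_hat_window; congr (_ / _); apply: eq_big_seq.
split=> //; rewrite /psi_hat !v_hat_window E.
by congr (if _ then _ else Num.sqrt (_ / _) * _ + _); apply: eq_big_seq => l /uu' ->.
Qed.

(** The sample variance is at most the sum of squares over [n - 1], and [n <= 2 * (n - 1)] for two
    or more samples. For one sample, [1 <= L] makes [M = 8 * c ^+ 2] at most [8 * (c * r) ^+ 2]. *)
Lemma psi_hat_le {R : realType} (c delta' H : R) (u : nat -> nat -> R)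
    (B : nat -> nat) (t k : nat) :
  let n : R := (Btk B t k)%:R in
  let L := ln (2 / delta') in
  let r := Num.sqrt (L / n) in
  0 < c -> 0 <= H -> 1 <= L -> (0 < Btk B t k)%N ->
  \sum_(l <- window B t k) u l.1 l.2 ^+ 2
    <= 2 * (n * (16 * c ^+ 2 * H ^+ 2)) + 32 * c ^+ 4 * L ->
  psi_hat (8 * c ^+ 2) delta' u B t k
  <= 12 * (c * H * r) + 55 * (c * r) ^+ 2.
Proof.
move=> n L r c0 H0 L1 n0 HS.
have n0' : 0 < n by rewrite ltr0n.
have r0 : 0 <= r by exact: sqrtr_ge0.
have Ln0 : 0 <= L / n by rewrite divr_ge0//; lra.
have r2 : r ^+ 2 = L / n by rewrite sqr_sqrtr.
have Lr : L = r ^+ 2 * n by rewrite r2 divfK ?gt_eqF.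
have cHr : 0 <= c * H * r by rewrite !mulr_ge0// ltW.
rewrite /psi_hat -/L -/n.
have [n1|n1] := eqVneq (Btk B t k) 1%N.
  have nE : n = 1 by rewrite /n n1.
  have : 1 * c ^+ 2 <= r ^+ 2 * c ^+ 2.
    by rewrite ler_wpM2r ?sqr_ge0// r2 nE divr1.
  rewrite exprMn; have := sqr_ge0 c; lra.
have n2 : 2 <= n by rewrite ler_nat; case: (Btk B t k) n0 n1 => [|[]].
have v8 : v_hat u B t k <= 8 * (c * H) + 8 * (c ^+ 2 * r).
  have rhs0 : 0 <= 8 * (c * H) + 8 * (c ^+ 2 * r).
    by rewrite addr_ge0// mulr_ge0// mulr_ge0// ?sqr_ge0// ltW.
  rewrite v_hat_window -[leRHS]ger0_norm// -sqrtr_sqr ler_wsqrtr//.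
  have s0 : (0 < size (window B t k))%N by rewrite size_window.
  have S := sum_square_shift (fun l => u l.1 l.2) 0 s0.
  rewrite /= -mu_hat_window size_window -/n subr0 in S.
  rewrite (eq_bigr (fun l => u l.1 l.2 ^+ 2)) in S; last by move=> l _; rewrite subr0.
  rewrite size_window -/n ler_pdivrMr; last lra.
  set Q := \sum_(l <- _) _; rewrite -/Q in S.
  have QS : Q <= 2 * (n * (16 * c ^+ 2 * H ^+ 2)) + 32 * c ^+ 4 * L.
    apply: le_trans HS; rewrite S lerDl mulr_ge0 ?sqr_ge0//; exact: ltW.
  apply: (@le_trans _ _ (64 * (c ^+ 2 * H ^+ 2 + c ^+ 4 * r ^+ 2) * (n - 1))).
    rewrite (le_trans QS)// Lr.
    have X0 : 0 <= c ^+ 2 * H ^+ 2 + c ^+ 4 * r ^+ 2.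
      by rewrite addr_ge0// mulr_ge0// exprn_ge0// ltW.
    have : 0 <= (c ^+ 2 * H ^+ 2 + c ^+ 4 * r ^+ 2) * (n - 2) by rewrite mulr_ge0// subr_ge0.
    lra.
  rewrite ler_wpM2r//; first lra.
  have : 0 <= c ^+ 2 * (c * H * r) by rewrite mulr_ge0 ?sqr_ge0.
  lra.
have [_ s0 s142] := @sqrt2_bounds R.
have -> : Num.sqrt (2 * L / n) = Num.sqrt 2 * r by rewrite -mulrA sqrtrM.
have h1 : v_hat u B t k * (Num.sqrt 2 * r)
    <= (8 * (c * H) + 8 * (c ^+ 2 * r)) * (71 / 50 * r).
  apply: ler_pM => //; first exact: sqrtr_ge0.
    by rewrite mulr_ge0// ltW.
  by rewrite ler_wpM2r.
have h2 : 8 * (8 * c ^+ 2) * L / (3 * (n - 1)) <= 128 / 3 * (c * r) ^+ 2.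
  rewrite ler_pdivrMr ?mulr_gt0//; last lra.
  have : 0 <= (c * r) ^+ 2 * (n - 2) by rewrite mulr_ge0 ?sqr_ge0// subr_ge0.
  rewrite Lr; lra.
(* The constants are 8 * 71/50 <= 12 and 8 * 71/50 + 128/3 <= 55. *)
have := sqr_ge0 (c * r); lra.
Qed.

Lemma mean_near {R : realType} {I : eqType} (s : seq I) (x : I -> R) (c gam : R) :
  (0 < size s)%N -> {in s, forall l, `|x l - c| <= gam} ->
  `|(\sum_(l <- s) x l) / (size s)%:R - c| <= gam.
Proof.
move=> s0 xc; have n0 : 0 < (size s)%:R :> R by rewrite ltr0n.
have Sc (y : R) : \sum_(l <- s) y = (size s)%:R * y.
  by rewrite big_const_seq count_predT iter_addr addr0 mulr_natl.
have -> : (\sum_(l <- s) x l) / (size s)%:R - c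
    = (\sum_(l <- s) (x l - c)) / (size s)%:R.
  by rewrite sumrB Sc mulrBl mulrAC mulfV ?gt_eqF// mul1r.
rewrite normrM normfV (gtr0_norm n0) ler_pdivrMr// mulrC -Sc.
by rewrite (le_trans (ler_norm_sum _ _ _))// big_seq [leRHS]big_seq; exact: ler_sum.
Qed.

(** Three failure events validate the radius; the fourth controls the sum of squares, from which
    [psi_hat_le] bounds the radius itself. *)
Lemma window_concentration {dO d} {Omega : measurableType dO}
    {Z : measurableType d} {R : realType} (Prob : probability Omega R)
    (z : nat -> nat -> Omega -> Z) (B : nat -> nat) (t k : nat)
    (h : Z -> R) (c delta' : R) :
  let u w j i := h (z j i w) in
  let M := 8 * c ^+ 2 in
  let L := ln (2 / delta') in
  0 < c -> 0 < L -> (0 < Btk B t k)%N ->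
  batches_indep Prob z B t ->
  {in window B t k, forall l, measurable_fun setT (z l.1 l.2)} ->
  measurable_fun setT h -> (forall x, `|h x| <= M / 2) ->
  holds_except Prob (fun w =>
    `|mu_hat (u w) B t k - (\sum_(l <- window B t k)
        \int[Prob]_x h (z l.1 l.2 x)) / (size (window B t k))%:R|
      <= psi_hat M delta' (u w) B t k /\
    \sum_(l <- window B t k) h (z l.1 l.2 w) ^+ 2
      <= 2 * (\sum_(l <- window B t k) \int[Prob]_x (h (z l.1 l.2 x) ^+ 2))
         + 32 * c ^+ 4 * L) (4 * expR (- L)).
Proof.
move=> u M L c0 L0 n0 indep mz mh hM.
have M0 : 0 < M by rewrite mulr_gt0// exprn_gt0.
have bh : bounded_measurable h by split=> //; exists (M / 2).
have s0 : (0 < size (window B t k))%N by rewrite size_window.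
have iw := independent_window k indep.
have H1 := empirical_bernstein (uniq_window B t k) mz iw mh hM M0 L0 s0.
have c40 : 0 < 32 * c ^+ 4 by rewrite mulr_gt0// exprn_gt0.
have h2 x : 2 * h x ^+ 2 <= 32 * c ^+ 4.
  have -> : 32 * c ^+ 4 = 2 * (M / 2) ^+ 2 by rewrite /M; field.
  rewrite ler_pM2l// -[h x ^+ 2]real_normK ?num_real// ler_sqr ?nnegrE//.
  by rewrite divr_ge0// ltW.
have H2 := sum_square_upper_tail L (uniq_window B t k) mz iw bh h2 c40.
have := holds_except_and H1 H2; apply: holds_except_sub; last lra.
move=> w [E1 E2]; split=> //.
rewrite mu_hat_window (le_trans E1)// /psi_hat v_hat_window mu_hat_window.
by rewrite size_window.
Qed.

Theorem mainTheorem9 :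
  exists C' : rat, 0 < C' /\
  forall (R : realType) (d : measure_display) (X : measurableType d)
    (M0 : R) (F : set (X -> R))
    (P : probability X R) (Pj : nat -> probability (X * R)%type R)
    (fstar : nat -> X -> R)
    (dO : measure_display) (Omega : measurableType dO)
    (Prob : probability Omega R)
    (B : nat -> nat) (z : nat -> nat -> Omega -> (X * R)%type)
    (t : nat) (delta : R) (f1 f2 : X -> R),
    0 < M0 ->
    (forall f, F f -> measurable_fun setT f /\ forall x, `|f x| <= M0) ->
    (forall j, (0 < j)%N -> {ae Pj j, forall w, `|w.2| <= M0}) ->
    (forall j (A : set X), (0 < j)%N -> measurable A -> Pj j (A `*` setT) = P A) ->
    (forall j, (0 < j)%N -> cond_exp_y P (Pj j) (fstar j)) ->
    (forall j, (1 <= j <= t)%N -> (1 <= B j)%N) ->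
    (forall j i, (1 <= j <= t)%N -> (i < B j)%N ->
       measurable_fun setT (z j i) /\
       forall A : set (X * R), measurable A ->
         Prob (z j i @^-1` A) = Pj j A) ->
    batches_indep Prob z B t ->
    (1 <= t)%N -> 0 < delta < 1 -> F f1 -> F f2 ->
    let delta' := delta / (3 * t%:R) in
    let M := 8 * M0 ^+ 2 in
    exists G : set Omega, measurable G /\ (Prob G >= (1 - delta)%:E)%E /\
      forall w, G w ->
        let u := fun j i => sqloss f1 (z j i w) - sqloss f2 (z j i w) in
        forall khat, is_khat M delta' u B t khat ->
          let fhat := arw_compare f1 f2 u B t khat in
          forall k, (1 <= k <= t)%N ->
            normP P (fun x => fhat x - fstar t x)
            - Num.min (normP P (fun x => f1 x - fstar t x))
                      (normP P (fun x => f2 x - fstar t x))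
            <= ratr C' * Num.sqrt (ln (6 * t%:R / delta)) *
               (\big[Num.max/0]_((t - k).+1 <= j < t.+1)
                   normP P (fun x => fstar j x - fstar t x)
                + M0 / Num.sqrt (Btk B t k)%:R).
Proof.
(* 331 is [2 * 165 + 1] from [selection_bound], with 165 three times the constant 55 of
   [psi_hat_le]. *)
exists 331%:R; split=> // R d X M0 F P Pj fstar dO Omega Prob B z t delta f1 f2.
move=> M00 HF Hy marg cexp HB Hz indep t1 /andP[d0 d1] F1 F2 delta' M.
have [mf1 f1c] := HF _ F1; have [mf2 f2c] := HF _ F2.
have M00' := ltW M00.
have bf1 : bounded_measurable f1 by split=> //; exists M0.
have bf2 : bounded_measurable f2 by split=> //; exists M0.
have tR : 1 <= t%:R :> R by rewrite ler1n.
have tR0 : 0 < t%:R :> R by exact: lt_le_trans tR.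
pose L := ln (2 / delta').
have LE : ln (6 * t%:R / delta) = L.
  by congr ln; rewrite /delta'; field; rewrite !gt_eqF.
have d'0 : 0 < 2 / delta' by rewrite !divr_gt0// mulr_gt0.
have d'E : 2 / delta' = 6 * t%:R / delta.
  by rewrite /delta'; field; rewrite !gt_eqF.
have expL : expR (- L) = delta / (6 * t%:R).
  by rewrite expRN lnK ?posrE// d'E invf_div.
(* Since [expR 1 <= 4], by squaring [expR (1/2) <= 2], and [6 * t / delta] exceeds 4. *)
have L1 : 1 <= L.
  rewrite -[leLHS](@expRK R) ler_ln ?posrE ?expR_gt0// d'E.
  have i2 : 0 <= 2^-1 :> R by rewrite invr_ge0.
  have e2 : expR (2^-1) <= 2 :> R.
    by rewrite (le_trans (expR_le_linear i2 (lexx _)))//; lra.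
  have -> : expR 1 = expR (2^-1) * expR (2^-1) :> R.
    by rewrite -expRD; congr expR; lra.
  apply: (@le_trans _ _ (2 * 2)); first by rewrite ler_pM// expR_ge0.
  by rewrite ler_pdivlMr//; nra.
have L0 : 0 < L by lra.
(* The given versions [fstar j] are merely integrable; computations use these bounded versions, and
   [Nfs] transfers norms back. *)
pose g j x := clip M0 (fstar j x).
have ver j : (0 < j)%N -> {ae P, forall x, fstar j x = g j x} /\
    forall phi, bounded_measurable phi ->
    \int[Pj j]_w (clip M0 w.2 * phi w.1) = \int[P]_x (g j x * phi x).
  move=> j0; apply: cond_exp_bounded_version => //; first exact: Hy.
  - by move=> A mA; exact: marg.
  - exact: cexp.
have mfs j : (0 < j)%N -> measurable_fun setT (fstar j).
  by move=> /cexp [].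
have bg j : (0 < j)%N -> bounded_measurable (g j).
  by move=> j0; apply: bounded_measurable_clip => //; exact: mfs.
pose h := loss_diff M0 f1 f2.
have mh : measurable_fun setT h by exact: measurable_loss_diff.
have hM x : `|h x| <= M / 2 by exact: loss_diff_norm_le.
have bh : bounded_measurable h by split=> //; exists (M / 2).
have bh2 := bounded_measurableX 2 bh.
pose H := normP P (fun x => f1 x - f2 x).
have H0 : 0 <= H by exact: normP_ge0.
pose a1 := normP P (fun x => f1 x - g t x).
pose a2 := normP P (fun x => f2 x - g t x).
pose D j := normP P (fun x => f1 x - g j x) ^+ 2 - normP P (fun x => f2 x - g j x) ^+ 2.
have zok k l : l \in window B t k -> [/\ (0 < l.1)%N, (1 <= l.1 <= t)%N,
    measurable_fun setT (z l.1 l.2) &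
    forall A : set (X * R), measurable A -> Prob (z l.1 l.2 @^-1` A) = Pj l.1 A].
  rewrite mem_window => /andP[/andP[tk lt] lB].
  have l1 : (0 < l.1)%N by exact: leq_ltn_trans tk.
  by have [|mz lz] := Hz l.1 l.2 _ lB; rewrite ?l1 ?lt.
have EzD k l : l \in window B t k -> \int[Prob]_x h (z l.1 l.2 x) = D l.1.
  move=> /zok[l0 _ mz lz]; rewrite (expect_law mz lz bh).
  apply: expect_loss_diff => //; first exact: bg.
  - by move=> A mA; exact: marg.
  - exact: (ver _ l0).2.
have Ez2 k l : l \in window B t k ->
    \int[Prob]_x (h (z l.1 l.2 x) ^+ 2) <= 16 * M0 ^+ 2 * H ^+ 2.
  move=> /zok[l0 _ mz lz]; rewrite (expect_law mz lz bh2).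
  by apply: expect_loss_diff_sqr => // A mA; exact: marg.
have n0 k : (1 <= k <= t)%N -> (0 < Btk B t k)%N.
  move=> /andP[k1 kt]; rewrite /Btk big_nat_recr/=; last by rewrite ltn_subrL k1.
  by rewrite addn_gt0 (HB t) ?orbT// t1 leqnn.
(* The window of length [t] contains every sample, so one null event covers all windows. *)
have AS : holds_except Prob
    (fun w => {in window B t t, forall l, `|(z l.1 l.2 w).2| <= M0}) 0.
  rewrite -[0](mulr0 (size (window B t t))%:R); apply: holds_except_all => l lw.
  have [l0 _ mz lz] := zok _ _ lw.
  pose A := [set p : X * R | `|p.2| <= M0].
  have mA : measurable A.
    have m2 : measurable_fun setT (fun p : X * R => `|p.2|).
      by apply: measurableT_comp => //; exact: measurable_snd.
    rewrite -[A]setTI.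
    have := m2 measurableT `]-oo, M0]%classic (measurable_itv _).
    by congr measurable; apply/seteqP; split=> p; rewrite /= in_itv.
  apply: (holds_except_ae (A := z l.1 l.2 @^-1` A)).
    by rewrite -[X in measurable X]setTI; exact: mz.
  rewrite lz//.
  have PAC : Pj l.1 (~` A) = 0%E.
    apply/negligibleP; first exact: measurableC.
    exact: Hy l0.
  have := probability_setC (Pj l.1) mA; rewrite PAC => /esym/eqP.
  by rewrite sube_eq ?add0e => [/eqP||]//; rewrite ?fin_num_measure.
pose m k := (\sum_(l <- window B t k) \int[Prob]_x h (z l.1 l.2 x))
   / (size (window B t k))%:R.
have conc : holds_except Prob (fun w => {in index_iota 1 t.+1, forall k,
    `|mu_hat (fun j i => h (z j i w)) B t k - m k|
      <= psi_hat M delta' (fun j i => h (z j i w)) B t k /\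
    \sum_(l <- window B t k) h (z l.1 l.2 w) ^+ 2
      <= 2 * (\sum_(l <- window B t k) \int[Prob]_x (h (z l.1 l.2 x) ^+ 2))
         + 32 * M0 ^+ 4 * L}) ((size (index_iota 1 t.+1))%:R * (4 * expR (- L))).
  apply: holds_except_all => k; rewrite mem_index_iota ltnS => kt.
  by apply: window_concentration => //; [exact: n0 | move=> l /zok[]].
have [G [mG PG GQ]] := holds_except_and AS conc.
exists G; split=> //; split.
  (* Union bound over [t] windows: [4 * t * (delta / (6 * t)) = 2 / 3 * delta], which leaves
     [delta / 3] to spare. *)
  rewrite -[G]setCK probability_setC; last exact: measurableC.
  rewrite EFinB leeB// (le_trans PG)// lee_fin add0r size_iota subn1/= expL.
  by rewrite le_eqVlt -subr_gt0; apply/orP; right; rewrite [X in 0 < X](_ : _ = delta / 3);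
    [rewrite divr_gt0 | field; rewrite gt_eqF].
move=> w /GQ[ASw concw] u khat kh fhat k kt.
have kt' := kt; move: kt' => /andP[k1 kt'].
have uE k' : {in window B t k', forall l, u l.1 l.2 = h (z l.1 l.2 w)}.
  move=> l lw; rewrite /u /h loss_diffE//; apply: ASw.
  have [_ lt' _ _] := zok _ _ lw; move: lw; rewrite !mem_window subnn => /andP[_ ->].
  by rewrite lt'.
have ext k' := @psi_hat_ext R M delta' u (fun j i => h (z j i w)) B t k' (uE k').
have conc1 k' : (1 <= k' <= t)%N -> `|mu_hat u B t k' - m k'| <= psi_hat M delta' u B t k'.
  move=> kt2; have [-> ->] := ext k'.
  by have [] := concw k'; rewrite ?mem_index_iota ?ltnS.
have Nfs (f : X -> R) j : measurable_fun setT f -> (0 < j)%N ->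
    normP P (fun x => f x - fstar j x) = normP P (fun x => f x - g j x).
  move=> mf j0; apply: normP_ae_eq.
  - by apply: measurable_funB => //; exact: mfs.
  - by apply: measurable_funB => //; exact: (bg _ j0).1.
  by have [fg _] := ver j j0; move: fg; apply: filterS => x ->.
pose be := \big[Num.max/0]_((t - k).+1 <= j < t.+1)
   normP P (fun x => fstar j x - fstar t x).
have be0 : 0 <= be by exact: bigmax_ge_id.
(* A window of length at most [k] averages only gaps [D j] with [j] in the range of [be], each
   within [2 * H * be] of [D t]. *)
have drift i : (1 <= i <= k)%N -> `|m i - D t| <= 2 * H * be.
  move=> /andP[i1 ik]; apply: mean_near.
    by rewrite size_window n0// i1 (leq_trans ik).
  move=> l lw; rewrite (EzD _ _ lw).
  have [l0 lt' _ _] := zok _ _ lw.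
  apply: le_trans (normP_sqr_diff_drift P bf1 bf2 (bg _ l0) (bg _ t1)) _.
  rewrite ler_wpM2l ?mulr_ge0//.
  have -> : normP P (fun x => g l.1 x - g t x)
      = normP P (fun x => fstar l.1 x - fstar t x).
    apply: normP_ae_eq.
    - by apply: measurable_funB; [exact: (bg _ l0).1 | exact: (bg _ t1).1].
    - by apply: measurable_funB; exact: mfs.
    have [fl _] := ver _ l0; have [ft _] := ver _ t1.
    by apply: filterS2 fl ft => x -> ->.
  apply: (le_bigmax_seq _ l.1) => //.
  move: lw; rewrite mem_window mem_index_iota ltnS => /andP[/andP[ti ->] _].
  by rewrite andbT (leq_ltn_trans _ ti)// leq_sub2l.
have dev := arw_deviation kh kt conc1 drift.
pose r := Num.sqrt (L / (Btk B t k)%:R).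
have nk := n0 k kt.
have nk0 : 0 < (Btk B t k)%:R :> R by rewrite ltr0n.
have psik : psi_hat M delta' u B t k <= 12 * (M0 * H * r) + 55 * (M0 * r) ^+ 2.
  apply: psi_hat_le => //.
  rewrite (eq_big_seq (fun l => h (z l.1 l.2 w) ^+ 2)); last by move=> l /uE ->.
  have [|_ S] := concw k; first by rewrite mem_index_iota ltnS.
  rewrite (le_trans S)// lerD2r ler_pM2l//.
  rewrite -size_window mulr_natl -[leRHS]addr0 -iter_addr -count_predT -big_const_seq.
  by rewrite big_seq [leRHS]big_seq; apply: ler_sum => l; exact: Ez2.
have r0 : 0 <= r by exact: sqrtr_ge0.
have Ha : H <= a1 + a2.
  rewrite (le_trans _ (normP_triangle P (bounded_measurableB bf1 (bg _ t1))
    (bounded_measurableB bf2 (bg _ t1))))// /H.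
  rewrite le_eqVlt; apply/orP; left; apply/eqP; congr normP.
  by apply/funext => x; ring.
have MHr : 0 <= M0 * H * r by rewrite !mulr_ge0.
(* Here [5 * gam] is [10 * H * be], and three radii add [36 * M0 * H * r + 165 * (M0 * r) ^+ 2]; the
   single constant 165 covers both terms, with [M0 * r] in the role of [r]. *)
have sel : (if mu_hat u B t khat <= 0 then a1 else a2) - Num.min a1 a2
    <= 10 * be + (2 * 165 + 1) * (M0 * r).
  apply: (selection_bound (H := H)) => //; try exact: normP_ge0; try exact: mulr_ge0.
  rewrite (le_trans dev)//; lra.
rewrite (Nfs f1)// (Nfs f2)// -/a1 -/a2.
have -> : normP P (fun x => fhat x - fstar t x) = if mu_hat u B t khat <= 0 then a1 else a2.
  by rewrite /fhat /arw_compare; case: ifP => _; rewrite Nfs.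
rewrite (le_trans sel)// -/be LE ratr_nat.
(* Needed so that the bias term may also carry the factor [Num.sqrt L]. *)
have sL1 : 1 <= Num.sqrt L by rewrite -[1]sqrtr1 ler_wsqrtr.
have -> : r = Num.sqrt L / Num.sqrt (Btk B t k)%:R.
  by rewrite /r sqrtrM ?ltW// sqrtrV// ltW.
have : be <= Num.sqrt L * be by rewrite ler_peMl.
have : 0 <= M0 * (Num.sqrt L / Num.sqrt (Btk B t k)%:R).
  by rewrite mulr_ge0// divr_ge0// sqrtr_ge0.
lra.
Qed.
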